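(* Let $K$ be a field, $S=K[x_1,\ldots,x_n]$, and $d\ge 2$ an integer. Let $u=x_1^{a_1}\cdots x_n^{a_n}$ with $a_1>0$ and $v=x_1^{b_1}\cdots x_n^{b_n}$ be monomials of degree $d$ with $u\ge_{\mathrm{lex}} v$, and suppose that $I=(L(u,v))\subset S$ is a completely lexsegment ideal. Then the following statements are equivalent: (1) $u$ and $v$ satisfy one of the following conditions: (i) $u=x_1^a x_2^{d-a}$ and $v=x_1^a x_n^{d-a}$ for some $a$ with $0<a\le d$; (ii) $b_1<a_1-1$; (iii) $b_1=a_1-1$ and, for the largest (with respect to $>_{\mathrm{lex}}$) monomial $w$ of degree $d$ with $w<_{\mathrm{lex}}v$, one has $x_1w/x_{\max(w)}\le_{\mathrm{lex}}u$. (2) $I$ has a linear resolution. (3) $I$ has linear quotients. (4) All the powers $I^N$, $N\ge 1$, have linear quotients. (5) All the powers $I^N$, $N\ge 1$, have a linear resolution.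
   Context: The lexicographic order on monomials is taken with $x_1>x_2>\cdots>x_n$. For monomials $u\ge_{\mathrm{lex}}v$ of degree $d$, $L(u,v)$ is the set of monomials $w$ of degree $d$ with $u\ge_{\mathrm{lex}}w\ge_{\mathrm{lex}}v$; sets of this form are called lexsegment sets, and $(L(u,v))$ is the ideal of $S$ generated by $L(u,v)$. The shadow of a set $B$ of monomials is $\{x_iw : w\in B,\ 1\le i\le n\}$. The ideal $(L(u,v))$ is a completely lexsegment ideal if all the iterated shadows of $L(u,v)$ are again lexsegment sets. For a monomial $w\neq 1$, $\max(w)$ is the largest index $i$ such that $x_i$ divides $w$. If $v=x_n^d$, so that no monomial $w<_{\mathrm{lex}}v$ of degree $d$ exists, the requirement on $w$ in (iii) is understood to be vacuous. A monomial ideal $J$ has linear quotients if its minimal monomial generators can be ordered $w_1,\ldots,w_r$ so that for every $2\le i\le r$ the colon ideal $(w_1,\ldots,w_{i-1}):w_i$ is generated by a subset of the variables. An ideal generated in a single degree $e$ has a linear resolution if its minimal graded free resolution over $S$ is $e$-linear. *)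

(* Defs.v *)
From HB Require Import structures.
From mathcomp Require Import all_boot all_order all_algebra.
From mathcomp.multinomials Require Import mpoly.

Set Implicit Arguments.
Unset Strict Implicit.
Unset Printing Implicit Defensive.

Import Order.TTheory GRing.Theory.
Local Open Scope ring_scope.

(* A monomial x_1^(m_1) ... x_n^(m_n) is its exponent vector m : 'X_{1..n};
   the index i : 'I_n stands for the variable x_(i+1). *)

(* The order that mpoly.v declares on 'X_{1..n} compares degrees first; this is
   the plain lexicographic order with x_1 > ... > x_n, on exponent vectors. *)
Definition lexle n (m1 m2 : 'X_{1..n}) : bool :=
  ((m1 : seqlexi nat) <= (m2 : seqlexi nat))%O.

Definition lexlt n (m1 m2 : 'X_{1..n}) : bool := (m1 != m2) && lexle m1 m2.

(* L(u, v), for u and v of the same degree *)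
Definition lexseg n (u v : 'X_{1..n}) (w : 'X_{1..n}) : Prop :=
  [/\ mdeg w = mdeg u, lexle w u & lexle v w].

Definition is_lexsegment n (B : 'X_{1..n} -> Prop) : Prop :=
  exists u v : 'X_{1..n},
    [/\ mdeg u = mdeg v, lexle v u & forall w, B w <-> lexseg u v w].

Definition shadow n (B : 'X_{1..n} -> Prop) (m : 'X_{1..n}) : Prop :=
  exists w i, B w /\ m = (U_(i) + w)%MM.

Definition completely_lexsegment n (u v : 'X_{1..n}) : Prop :=
  forall k, is_lexsegment (iter k (@shadow n) (lexseg u v)).

(* max(w), as an index; junk value for w = 1 *)
Definition max_index n (w : 'X_{1..n.+1}) : 'I_n.+1 :=
  inord (\max_(i < n.+1 | (0 < w i)%N) i)%N.

Definition is_lex_pred n (v w : 'X_{1..n}) : Prop :=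
  [/\ mdeg w = mdeg v, lexlt w v
    & forall w', mdeg w' = mdeg v -> lexlt w' v -> lexle w' w].

Definition in_seq (T : eqType) (s : seq T) (x : T) : Prop := x \in s.

Section Ideals.
Variables (K : fieldType) (n : nat).
Local Notation S := {mpoly K[n]}.
Implicit Types (G I J : S -> Prop) (B : 'X_{1..n} -> Prop).

Definition eqideal I J : Prop := forall p, I p <-> J p.

Definition ideal_gen G (p : S) : Prop :=
  exists s : seq (S * S),
    (forall x, x \in s -> G x.2) /\ p = \sum_(x <- s) x.1 * x.2.

Definition mon_ideal B : S -> Prop :=
  ideal_gen (fun q => exists2 m, B m & q = 'X_[m]).

Definition var_ideal (A : {set 'I_n}) : S -> Prop :=
  ideal_gen (fun q => exists2 i, i \in A & q = 'X_i).

Definition ideal_pow I (N : nat) : S -> Prop :=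
  ideal_gen (fun q => exists f : 'I_N -> S,
    (forall i, I (f i)) /\ q = \prod_(i < N) f i).

Definition colon I (g p : S) : Prop := I (p * g).

(* s lists, without repetition, the minimal monomial generators of J *)
Definition minimal_mon_gens J (s : seq 'X_{1..n}) : Prop :=
  [/\ uniq s, eqideal J (mon_ideal (in_seq s))
    & forall m, m \in s -> ~ mon_ideal (in_seq (rem m s)) 'X_[m]].

Definition has_linear_quotients J : Prop :=
  exists s : seq 'X_{1..n}, minimal_mon_gens J s /\
    forall i, (0 < i < size s)%N ->
      exists A : {set 'I_n},
        eqideal (colon (mon_ideal (in_seq (take i s))) 'X_[nth 0%MM s i])
                (var_ideal A).

(* A graded free resolution ... -> F_1 -> F_0 -> J -> 0 over S, with
   F_i = (+)_j S(- gfr_twist i j).  Elements of F_i are row vectors, on which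
   matrices act from the right.  An entry p of the matrix of a degree-preserving
   map S(-a) -> S(-b) is homogeneous of degree a - b (in particular p = 0 if
   a < b). *)
Record graded_free_resolution J := GradedFreeResolution {
  gfr_rank : nat -> nat;
  gfr_twist : forall i, 'I_(gfr_rank i) -> int;
  gfr_aug : 'cV[S]_(gfr_rank 0);
  gfr_diff : forall i, 'M[S]_(gfr_rank i.+1, gfr_rank i);
  gfr_aug_homog : forall j m, m \in msupp (gfr_aug j 0) ->
    (mdeg m)%:Z = gfr_twist j;
  gfr_diff_homog : forall i j k m, m \in msupp (gfr_diff i j k) ->
    (mdeg m)%:Z = gfr_twist j - gfr_twist k;
  gfr_aug_image : forall p : S,
    J p <-> exists x : 'rV[S]_(gfr_rank 0), p = (x *m gfr_aug) 0 0;
  gfr_exact0 : forall x : 'rV[S]_(gfr_rank 0),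
    x *m gfr_aug = 0 <-> exists y, x = y *m gfr_diff 0;
  gfr_exact : forall i (x : 'rV[S]_(gfr_rank i.+1)),
    x *m gfr_diff i = 0 <-> exists y, x = y *m gfr_diff i.+1 }.

(* F_(i+1) is mapped into (x_1, ..., x_n) F_i *)
Definition gfr_minimal J (F : graded_free_resolution J) : Prop :=
  forall i j k, var_ideal [set: 'I_n] (gfr_diff F i j k).

Definition gfr_linear J (e : nat) (F : graded_free_resolution J) : Prop :=
  forall i (j : 'I_(gfr_rank F i)), gfr_twist j = (e + i)%N%:Z.

Definition generated_in_degree J (e : nat) : Prop :=
  exists2 s : seq S, (forall f, f \in s -> f \is e.-homog)
                   & eqideal J (ideal_gen (in_seq s)).

(* The minimal graded free resolution is unique up to isomorphism, and so are
   its twists up to order. *)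
Definition has_linear_resolution J : Prop :=
  exists e, generated_in_degree J e /\
    exists F : graded_free_resolution J, gfr_minimal F /\ gfr_linear e F.

End Ideals.

(* Main.v *)
(* Write a_1, b_1 for the x_1-exponents of u, v.

   (1) => (4).  Order the generators of I^N decreasingly for the lexicographic
   order with x_2 > ... > x_n > x_1.  Let w, w' be products of N elements of
   L(u, v) first differing at x_q, where w' has the larger exponent.  If some
   factor of w has x_1-exponent > b_1 + 1, or contains a variable x_j with
   1 < q < j, condition (1) allows trading x_1 or some x_j with j > q for x_q
   inside one factor.  Otherwise the
   letters of w other than x_1, followed by x_q, form an initial part s of the
   sorted word of w'; by degree reasons w' has more factors of x_1-exponent b_1
   than w.  Cut s into a prefix and a suffix: letterwise, the prefix is at most a
   product of such factors of w' and the suffix is at least a product of factors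
   of w of x_1-exponent b_1 + 1.  As the layer b_1 of L(u, v) is closed under
   decreasing indices and the layer b_1 + 1 under increasing them, x_q w / x_1
   lies in I^N.

   (4) => (5).  Linear quotients yield a linear resolution by adding generators
   one at a time, with the horseshoe lemma applied to the syzygy modules.

   (2) => (1).  If a_1 = b_1, the first shadow forces (i).  If (iii) fails,
   z = w / x_max(w) satisfies x_n z < v and x_1 z > u.  The Hilbert function of a
   completely lexsegment ideal counts monomials in a lexsegment, and its n-th
   difference in degree d + n - 1 shows that the last Betti number of a linear
   resolution would be #{z | x_n z >= v} - #{z | x_1 z > u}, z ranging over the
   monomials of degree d - 1; this is negative. *)
From HB Require Import structures.
From Stdlib Require ClassicalEpsilon.
Require Import Defs.
From mathcomp Require Import all_boot all_order all_algebra zify.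
From mathcomp.multinomials Require Import mpoly.

Set Implicit Arguments.
Unset Strict Implicit.
Unset Printing Implicit Defensive.

Import Order.TTheory GRing.Theory.
Local Open Scope ring_scope.

(** * The lexicographic order and monomial ideals *)

Section Lex.
Variable n : nat.
Implicit Types m : 'X_{1..n}.

Lemma lexle_refl m : lexle m m.
Proof. exact: lexx. Qed.

Lemma lexle_trans : transitive (@lexle n).
Proof. by move=> m2 m1 m3; apply: le_trans. Qed.

Lemma lexle_total : total (@lexle n).
Proof. by move=> m1 m2; apply: le_total. Qed.

Lemma lexle_anti : antisymmetric (@lexle n).
Proof.
by move=> m1 m2 /(@le_anti _ (seqlexi nat)) h; apply/val_inj/val_inj.
Qed.

Lemma lexltE m1 m2 :
  lexlt m1 m2 = ((m1 : seqlexi nat) < (m2 : seqlexi nat))%O.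
Proof. by rewrite /lexlt lt_neqAle. Qed.

Lemma lexltP m1 m2 : reflect
  (exists2 i : 'I_n, forall j : 'I_n, (j < i)%N -> m1 j = m2 j
     & (m1 i < m2 i)%N)
  (lexlt m1 m2).
Proof. by rewrite lexltE; apply: ltxi_tuplePlt. Qed.

Lemma lexltNge m1 m2 : lexlt m1 m2 = ~~ lexle m2 m1.
Proof. by rewrite lexltE ltNge. Qed.

Lemma lexleNgt m1 m2 : lexle m1 m2 = ~~ lexlt m2 m1.
Proof. by rewrite lexltNge negbK. Qed.

Lemma lexltW m1 m2 : lexlt m1 m2 -> lexle m1 m2.
Proof. by case/andP. Qed.

Lemma lexle_lt_trans m2 m1 m3 : lexle m1 m2 -> lexlt m2 m3 -> lexlt m1 m3.
Proof. by rewrite !lexltE; apply: le_lt_trans. Qed.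

Lemma lexlt_le_trans m2 m1 m3 : lexlt m1 m2 -> lexle m2 m3 -> lexlt m1 m3.
Proof. by rewrite !lexltE; apply: lt_le_trans. Qed.

Lemma lexltD2l m m1 m2 : lexlt (m + m1)%MM (m + m2)%MM = lexlt m1 m2.
Proof.
apply/lexltP/lexltP => -[i eq lt]; exists i.
- by move=> j /eq; rewrite !mnmDE => /addnI.
- by move: lt; rewrite !mnmDE ltn_add2l.
- by move=> j /eq; rewrite !mnmDE => ->.
- by rewrite !mnmDE ltn_add2l.
Qed.

Lemma lexleD2l m m1 m2 : lexle (m + m1)%MM (m + m2)%MM = lexle m1 m2.
Proof. by rewrite !lexleNgt lexltD2l. Qed.

Lemma lexleD m1 m2 m3 m4 :
  lexle m1 m2 -> lexle m3 m4 -> lexle (m1 + m3)%MM (m2 + m4)%MM.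
Proof.
move=> h1 h2; apply: (@lexle_trans (m1 + m4)%MM); first by rewrite lexleD2l.
by rewrite ![(_ + m4)%MM]addmC lexleD2l.
Qed.

End Lex.

Lemma lexle_ord0 n (m1 m2 : 'X_{1..n.+1}) :
  lexle m1 m2 -> (m1 ord0 <= m2 ord0)%N.
Proof.
rewrite lexleNgt leqNgt; apply: contra => lt0; apply/lexltP.
by exists ord0.
Qed.

Lemma lexlt_ord0 n (m1 m2 : 'X_{1..n.+1}) :
  (m1 ord0 < m2 ord0)%N -> lexlt m1 m2.
Proof. by move=> lt0; apply/lexltP; exists ord0. Qed.

Definition mswap n (i j : 'I_n) (m : 'X_{1..n}) : 'X_{1..n} :=
  (U_(i) + m - U_(j))%MM.

Section Swap.
Variable n : nat.
Implicit Types (m : 'X_{1..n}) (i j k : 'I_n).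

Lemma mswapE i j m k : mswap i j m k = ((i == k) + m k - (j == k))%N.
Proof. by rewrite mnmBE mnmDE !mnm1E. Qed.

Lemma mswapK i j m : (0 < m j)%N -> (U_(j) + mswap i j m = U_(i) + m)%MM.
Proof.
move=> mj; rewrite addmC submK //; apply/mnm_lepP => k.
by rewrite mnm1E mnmDE; case: eqP => // <-; lia.
Qed.

Lemma mdeg_mswap i j m : (0 < m j)%N -> mdeg (mswap i j m) = mdeg m.
Proof.
move=> mj; have := congr1 (@mdeg _) (mswapK i mj).
by rewrite !mdegD !mdeg1; lia.
Qed.

Lemma mswap_id i m : (0 < m i)%N -> mswap i i m = m.
Proof. by move=> mi; apply/mnmP => k; rewrite mswapE; case: eqP => [<-|_]; lia. Qed.

Lemma mswap_gt i j m : (0 < m j)%N -> (i < j)%N -> lexlt m (mswap i j m).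
Proof.
move=> mj ij; have ji : (j == i) = false by apply/eqP => e; move: ij; rewrite e ltnn.
apply/lexltP; exists i; last by rewrite mswapE eqxx ji; lia.
move=> k ki; rewrite mswapE.
have -> : (i == k) = false by apply/eqP => e; move: ki; rewrite e ltnn.
have -> : (j == k) = false by apply/eqP => e; move: ki; rewrite -e; lia.
by rewrite subn0.
Qed.

Lemma mswap_lt i j m : (0 < m j)%N -> (j < i)%N -> lexlt (mswap i j m) m.
Proof.
move=> mj ij; have ji : (i == j) = false by apply/eqP => e; move: ij; rewrite e ltnn.
apply/lexltP; exists j; last by rewrite mswapE eqxx ji; lia.
move=> k ki; rewrite mswapE.
have -> : (j == k) = false by apply/eqP => e; move: ki; rewrite e ltnn.
have -> : (i == k) = false by apply/eqP => e; move: ki; rewrite -e; lia.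
by rewrite subn0.
Qed.

End Swap.

Lemma mswap_ord0 n (i j : 'I_n.+1) m : i != ord0 -> j != ord0 ->
  mswap i j m ord0 = m ord0.
Proof. by rewrite mswapE => /negPf -> /negPf ->; rewrite subn0. Qed.

Section MonIdeal.
Variables (K : fieldType) (n : nat).
Local Notation S := {mpoly K[n]}.
Implicit Types (B : 'X_{1..n} -> Prop) (p q : S) (I : S -> Prop).

Lemma ideal_gen_mem (G : S -> Prop) g : G g -> ideal_gen G g.
Proof.
move=> Gg; exists [:: (1, g)]; split; last by rewrite big_seq1 mul1r.
by move=> x; rewrite inE => /eqP ->.
Qed.

Lemma ideal_genD (G : S -> Prop) p q :
  ideal_gen G p -> ideal_gen G q -> ideal_gen G (p + q).
Proof.
move=> [s [hs ->]] [t [ht ->]]; exists (s ++ t); split; last by rewrite big_cat.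
by move=> x; rewrite mem_cat => /orP [/hs|/ht].
Qed.

Lemma ideal_gen0 (G : S -> Prop) : ideal_gen G 0.
Proof. by exists [::]; split => //; rewrite big_nil. Qed.

Lemma ideal_genMl (G : S -> Prop) r p : ideal_gen G p -> ideal_gen G (r * p).
Proof.
move=> [s [hs ->]]; exists [seq (r * x.1, x.2) | x <- s]; split.
  by move=> x /mapP [y /hs Gy ->].
by rewrite big_map mulr_sumr; apply: eq_bigr => x _; rewrite mulrA.
Qed.

Lemma ideal_gen_sum (G : S -> Prop) (T : eqType) (s : seq T) (F : T -> S) :
  (forall x, x \in s -> ideal_gen G (F x)) -> ideal_gen G (\sum_(x <- s) F x).
Proof.
elim: s => [|x s IH] h; first by rewrite big_nil; apply: ideal_gen0.
rewrite big_cons; apply: ideal_genD; first by apply: h; rewrite mem_head.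
by apply: IH => y ys; apply: h; rewrite inE ys orbT.
Qed.

Lemma mon_idealP B p :
  mon_ideal B p <-> forall m, m \in msupp p -> exists2 g, B g & (g <= m)%MM.
Proof.
split.
  move=> [s [hs ->]] m /(msupp_sum_le (F := fun x : S * S => x.1 * x.2)).
  rewrite filter_predT => /flattenP [t /mapP [x xs ->]] /msuppM_le /allpairsP.
  have [g Bg ->] := hs _ xs.
  move=> [[m1 m2] /= [_ ]]; rewrite msuppX inE => /eqP -> ->.
  by exists g => //; apply: lem_addl.
move=> h; rewrite (mpolyE p); apply: ideal_gen_sum => m /h [g Bg gm].
rewrite -(submK gm) mpolyXD scalerAl; apply: ideal_genMl.
by apply: ideal_gen_mem; exists g.
Qed.

Lemma mon_idealX B m : mon_ideal (K := K) B 'X_[m] <-> exists2 g, B g & (g <= m)%MM.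
Proof.
rewrite mon_idealP; split => [h|h k]; first by apply: h; rewrite msuppX mem_head.
by rewrite msuppX inE => /eqP ->.
Qed.

Lemma mon_ideal_mem B m : B m -> mon_ideal (K := K) B 'X_[m].
Proof. by move=> Bm; apply/mon_idealX; exists m => //; apply: lepm_refl. Qed.

Lemma var_idealE (A : {set 'I_n}) :
  eqideal (var_ideal (K := K) A)
    (mon_ideal (fun m => exists2 i, i \in A & m = U_(i)%MM)).
Proof.
move=> p; split => -[s [hs ->]]; exists s; split => // x /hs.
  by move=> [i iA ->]; exists U_(i)%MM => //; exists i.
by move=> [_ [i iA ->] ->]; exists i.
Qed.

Lemma var_idealP (A : {set 'I_n}) p :
  var_ideal A p <->
  forall m, m \in msupp p -> exists2 i, i \in A & (0 < m i)%N.
Proof.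
rewrite var_idealE mon_idealP; split => h m /h.
  by move=> [_ [i iA ->]]; rewrite lep1mP => mi; exists i; rewrite ?lt0n.
by move=> [i iA mi]; exists U_(i)%MM; [exists i | rewrite lep1mP -lt0n].
Qed.

Lemma colonP B w p :
  colon (mon_ideal B) 'X_[w] p <->
  forall m, m \in msupp p -> exists2 g, B g & (g <= m + w)%MM.
Proof.
rewrite /colon mon_idealP; split => h m hm.
  apply: h; rewrite (perm_mem (msuppMX _ _)); apply/mapP.
  by exists m => //; rewrite addmC.
move: hm; rewrite (perm_mem (msuppMX _ _)) => /mapP [m' /h [g Bg gm] ->].
by exists g => //; rewrite addmC.
Qed.

Lemma eqideal_mon B B' : (forall m, B m <-> B' m) ->
  eqideal (mon_ideal (K := K) B) (mon_ideal B').
Proof.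
by move=> h p; rewrite !mon_idealP; split => hp m /hp [g /h Bg gm]; exists g.
Qed.

End MonIdeal.

(** * Exchange property of products of a lexsegment *)

Lemma all2_andl (T : Type) (p : pred T) (r : rel T) s t :
  all p s -> all2 r s t -> all2 (fun x y => p x && r x y) s t.
Proof.
by elim: s t => [|x s IH] [|y t] //= /andP [-> /IH h] /andP [-> /h ->].
Qed.

Lemma all2_flip (S T : Type) (r : S -> T -> bool) s t :
  all2 r s t -> all2 (fun y x => r x y) t s.
Proof. by elim: s t => [|x s IH] [|y t] //= /andP [-> /IH]. Qed.

Section SortedWords.
Variables (T : eqType) (r : rel T).
Hypotheses (r_refl : reflexive r) (r_trans : transitive r).

Lemma sorted_shift y s t k : path r y s -> size t = k ->
  all2 r (take k s) t -> all2 r (take k (y :: s)) t.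
Proof.
elim: k s y t => [|k IH] [|z s] y [|x t] //= /andP[yz pz] [st] /andP[zx h].
by rewrite (r_trans yz zx) IH.
Qed.

Lemma subseq_sorted_take s t : sorted r s -> subseq t s ->
  all2 r (take (size t) s) t.
Proof.
elim: s t => [|y s IH] [|x t] //= ps; case: eqP => [->|_] sub.
  by rewrite r_refl IH ?(path_sorted ps).
exact: (@sorted_shift y s (x :: t) _ ps erefl (IH _ (path_sorted ps) sub)).
Qed.

Lemma subseq_sorted_drop s t : sorted r s -> subseq t s ->
  all2 r t (drop (size s - size t) s).
Proof.
elim: s t => [|y s IH] [|x t] //= ps; first by rewrite drop_size.
case: eqP => [->|_] sub.
  have := IH _ (path_sorted ps) sub; rewrite subSS.
  case e: (size s - size t)%N => [|k] h.
    by rewrite drop0 /= r_refl; move: h; rewrite drop0.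
  have ks : (k < size s)%N by lia.
  rewrite /= (drop_nth y ks) /= h andbT.
  by move: (order_path_min r_trans ps) => /allP; apply; apply: mem_nth.
have st := size_subseq sub; rewrite /= in st.
by rewrite subSn //; apply: (IH (x :: t) (path_sorted ps) sub).
Qed.

End SortedWords.

Section Words.
Variable n : nat.
Implicit Types (m : 'X_{1..n}) (s t : seq 'I_n).

Lemma s2mE s i : s2m s i = count_mem i s.
Proof. by rewrite mnmE. Qed.

Lemma count_m2s m i : count_mem i (m2s m) = m i.
Proof. by rewrite -s2mE s2mK. Qed.

Lemma s2m_cons i s : s2m (i :: s) = (U_(i) + s2m s)%MM.
Proof. by apply/mnmP => k; rewrite mnmDE mnm1E !s2mE. Qed.

Lemma s2m_cat s t : s2m (s ++ t) = (s2m s + s2m t)%MM.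
Proof. by apply/mnmP => k; rewrite mnmDE !s2mE count_cat. Qed.

Lemma s2m_perm s t : perm_eq s t -> s2m s = s2m t.
Proof. by move=> /permP st; apply/mnmP => k; rewrite !s2mE st. Qed.

Definition ordle : rel 'I_n := fun i j => (i <= j)%N.

Lemma ordle_refl : reflexive ordle. Proof. by move=> i; apply: leqnn. Qed.
Lemma ordle_trans : transitive ordle. Proof. by move=> j i k; apply: leq_trans. Qed.

Lemma m2s_sorted m : sorted ordle (m2s m).
Proof. by have := srt_m2s m; rewrite sorted_map. Qed.

Lemma subseq_m2s m1 m2 : (m1 <= m2)%MM ->
  exists2 s, subseq s (m2s m2) & s2m s = m1.
Proof.
move=> /mnm_lepP le12; have /count_subseqP [s ss ps] :
    forall i, (count_mem i (m2s m1) <= count_mem i (m2s m2))%N.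
  by move=> i; rewrite !count_m2s.
by exists s => //; rewrite -(s2m_perm ps) s2mK.
Qed.

Lemma moves_all2 (r : rel 'I_n) (P : 'X_{1..n} -> Prop) s t c :
  (forall i j m, r i j -> (0 < m j)%N -> P m -> P (mswap i j m)) ->
  all2 r s t -> P (c + s2m t)%MM -> P (c + s2m s)%MM.
Proof.
move=> Pr; elim: s t c => [|x s IH] [|y t] c //= /andP[xy st].
rewrite !s2m_cons !addmA => h; apply: (IH t) => //.
suff -> : (c + U_(x) + s2m t)%MM = mswap x y (c + U_(y) + s2m t)%MM.
  by apply: Pr => //; rewrite !mnmDE mnm1E eqxx; lia.
by apply/mnmP => k; rewrite mswapE !mnmDE !mnm1E; lia.
Qed.

End Words.

Section Products.
Variable n : nat.
Implicit Types (m g : 'X_{1..n}) (gs : seq 'X_{1..n}) (L : 'X_{1..n} -> Prop).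

Definition msum gs : 'X_{1..n} := (\sum_(g <- gs) g)%MM.

Definition prodset L N m : Prop :=
  exists gs, [/\ size gs = N, forall g, g \in gs -> L g & m = msum gs].

Lemma msum_cat gs hs : msum (gs ++ hs) = (msum gs + msum hs)%MM.
Proof. exact: big_cat. Qed.

Lemma msum_cons g gs : msum (g :: gs) = (g + msum gs)%MM.
Proof. exact: big_cons. Qed.

Lemma msum_subseq gs hs : subseq gs hs -> (msum gs <= msum hs)%MM.
Proof.
elim: hs gs => [|h hs IH] [|g gs] //=; try by rewrite ?lepm_refl.
  by move=> _; rewrite /msum big_nil; apply/mnm_lepP => i; rewrite mnm0E.
case: eqP => [->|_] /IH /mnm_lepP le; apply/mnm_lepP => i; have := le i.
  by rewrite !msum_cons !mnmDE; lia.
by rewrite !msum_cons !mnmDE; lia.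
Qed.

Lemma mdeg_msum gs d : (forall g, g \in gs -> mdeg g = d) ->
  mdeg (msum gs) = (size gs * d)%N.
Proof.
elim: gs => [|g gs IH] h; first by rewrite /msum big_nil mdeg0.
rewrite msum_cons mdegD IH ?h ?mem_head //= ?mulSn //.
by move=> x xs; apply: h; rewrite inE xs orbT.
Qed.

Lemma prodsetD L p q m m' :
  prodset L p m -> prodset L q m' -> prodset L (p + q) (m + m')%MM.
Proof.
move=> [s [<- hs ->]] [t [<- ht ->]]; exists (s ++ t); split.
- by rewrite size_cat.
- by move=> g; rewrite mem_cat => /orP [/hs|/ht].
- by rewrite msum_cat.
Qed.

Lemma prodset_mono L L' N m :
  (forall g, L g -> L' g) -> prodset L N m -> prodset L' N m.
Proof. by move=> LL' [gs [sz hg ->]]; exists gs; split=> // g /hg /LL'. Qed.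

Lemma prodset_replace L gs g i j :
  (forall x, x \in gs -> L x) -> g \in gs -> (0 < g j)%N ->
  L (mswap i j g) -> prodset L (size gs) (mswap i j (msum gs)).
Proof.
move=> hL ggs gj Lg'; have pgs := perm_to_rem ggs.
exists (mswap i j g :: rem g gs); split.
- by rewrite (perm_size pgs).
- by move=> x; rewrite inE => /orP [/eqP ->|/mem_rem /hL].
- rewrite msum_cons /msum (perm_big _ pgs) big_cons /=.
  by apply/mnmP => k; rewrite mswapE !mnmDE mswapE; case: (j =P k) => [<-|_]; lia.
Qed.

Lemma msum_gt0 gs j : (0 < msum gs j)%N -> exists2 g, g \in gs & (0 < g j)%N.
Proof.
elim: gs => [|g gs IH]; first by rewrite /msum big_nil mnm0E.
rewrite msum_cons mnmDE addn_gt0 => /orP [gj|/IH [h hgs hj]].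
  by exists g; rewrite ?mem_head.
by exists h; rewrite // inE hgs orbT.
Qed.

Lemma prodset_move L N i j m :
  (forall g, L g -> (0 < g j)%N -> L (mswap i j g)) ->
  (0 < m j)%N -> prodset L N m -> prodset L N (mswap i j m).
Proof.
move=> Lij mj [gs [<- hL em]]; move: mj; rewrite em => /msum_gt0 [g ggs gj].
by apply: (prodset_replace hL ggs gj); apply: Lij => //; apply: hL.
Qed.

End Products.

Section Exchange.
Variables (n d b : nat) (L : 'X_{1..n.+1} -> Prop).
Implicit Types (g w m : 'X_{1..n.+1}) (i j q : 'I_n.+1).

Definition strip0 w : 'X_{1..n.+1} :=
  [multinom if i == ord0 then 0%N else w i | i < n.+1].

Lemma strip0E w i : strip0 w i = if i == ord0 then 0%N else w i.
Proof. exact: mnmE. Qed.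

Lemma strip0K w : (U_(ord0) *+ w ord0 + strip0 w)%MM = w.
Proof.
apply/mnmP => i; rewrite mnmDE mulmnE mnm1E strip0E eq_sym.
by case: eqP => [->|_]; lia.
Qed.

Lemma mdeg_strip0 w : (w ord0 + mdeg (strip0 w))%N = mdeg w.
Proof. by rewrite -{3}(strip0K w) mdegD mdegMn mdeg1 mul1n. Qed.

Lemma strip0_le w1 w2 : (w1 <= w2)%MM -> (strip0 w1 <= strip0 w2)%MM.
Proof.
by move=> /mnm_lepP h; apply/mnm_lepP => i; rewrite !strip0E; case: ifP.
Qed.

(* By condition (1) these hold for L = L(u, v), b being the x_1-exponent of v. *)
Hypotheses (L_deg : forall g, L g -> mdeg g = d)
  (L_ord0 : forall g, L g -> (b <= g ord0)%N)
  (L_high : forall g q, L g -> (b.+1 < g ord0)%N -> q != ord0 ->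
     L (mswap q ord0 g))
  (L_low : forall g i j, L g -> g ord0 = b -> (0 < i < j)%N -> (0 < g j)%N ->
     L (mswap i j g))
  (L_mid : forall g q j, L g -> g ord0 = b.+1 -> q != ord0 -> (q < j)%N ->
     (0 < g j)%N ->
     exists k, [/\ (k == ord0) || (q < k)%N, (0 < g k)%N & L (mswap q k g)])
  (L_mid_up : forall g i j, L g -> g ord0 = b.+1 -> (0 < i < j)%N ->
     (0 < g i)%N -> L (mswap j i g)).

Lemma prodset_deg N w : prodset L N w -> mdeg w = (N * d)%N.
Proof.
by move=> [gs [<- hL ->]]; apply: mdeg_msum => g /hL /L_deg.
Qed.

Lemma msum_ord0_ge gs : (forall g, g \in gs -> L g) ->
  (size gs * b.+1 <= msum gs ord0 + count (fun g => g ord0 == b) gs)%N.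
Proof.
elim: gs => [|g gs IH] h; first by rewrite mul0n.
have := IH (fun x xs => h x (mem_behead (s := g :: gs) xs)).
have := L_ord0 (h g (mem_head _ _)).
rewrite msum_cons mnmDE /= mulSn; case: eqP => /=; lia.
Qed.

Lemma msum_ord0_eq gs c : (forall g, g \in gs -> g ord0 = c) ->
  msum gs ord0 = (size gs * c)%N.
Proof.
elim: gs => [|g gs IH] h; first by rewrite /msum big_nil mnm0E.
rewrite msum_cons mnmDE IH ?h ?mem_head ?mulSn //.
by move=> x xs; apply: h; rewrite inE xs orbT.
Qed.

Let Lat c g := L g /\ g ord0 = c.

Lemma Lat_low_move N i j m : (0 < i)%N && (i <= j)%N -> (0 < m j)%N ->
  prodset (Lat b) N m -> prodset (Lat b) N (mswap i j m).
Proof.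
move=> /andP [i0 ij] mj; apply: prodset_move => // g [Lg g0] gj.
move: ij; rewrite leq_eqVlt => /orP [/eqP/val_inj ->|ij].
  by rewrite mswap_id.
split; first by apply: L_low => //; rewrite i0.
by rewrite mswap_ord0 // -val_eqE /=; lia.
Qed.

Lemma Lat_mid_move N i j m : (0 < j)%N && (j <= i)%N -> (0 < m j)%N ->
  prodset (Lat b.+1) N m -> prodset (Lat b.+1) N (mswap i j m).
Proof.
move=> /andP [j0 ji] mj; apply: prodset_move => // g [Lg g0] gj.
move: ji; rewrite leq_eqVlt => /orP [/eqP/val_inj <-|ji].
  by rewrite mswap_id.
split; first by apply: L_mid_up => //; rewrite j0.
by rewrite mswap_ord0 // -val_eqE /=; lia.
Qed.

Lemma word_prefix w w' q : q != ord0 ->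
  (forall j, (q < j)%N -> w j = 0%N) ->
  (forall j, j != ord0 -> (j < q)%N -> w j = w' j) -> (w q < w' q)%N ->
  exists z, m2s (strip0 w') = rcons (m2s (strip0 w)) q ++ z.
Proof.
move=> q0 wq ww' lt; set W := strip0 w; set W' := strip0 w'.
have leW : (W + U_(q) <= W')%MM.
  apply/mnm_lepP => i; rewrite mnmDE mnm1E !strip0E.
  case: eqP => [->|/eqP i0]; first by rewrite (negPf q0).
  case: (ltngtP i q) => [iq|qi|/val_inj ->]; last by rewrite eqxx; lia.
    by rewrite (ww' _ i0 iq) (_ : q == i = false) ?addn0 // -val_eqE gtn_eqF.
  by rewrite wq // (_ : q == i = false) // -val_eqE ltn_eqF.
exists (m2s (W' - (W + U_(q)))%MM).
apply: (@sorted_eq _ (@ordle n.+1)) => //.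
- exact: ordle_trans.
- by move=> i j /andP [ij ji]; apply/val_inj/eqP; rewrite eqn_leq; apply/andP.
- exact: m2s_sorted.
- have mem_m2s m (i : 'I_n.+1) : i \in m2s m -> (0 < m i)%N.
    by rewrite -count_m2s -has_count has_pred1.
  have zq j : j \in m2s (W' - (W + U_(q)))%MM -> (q <= j)%N.
    move/mem_m2s; rewrite mnmBE mnmDE mnm1E !strip0E.
    case: (j =P ord0) => // /eqP j0; case: (leqP q j) => // jq.
    by rewrite (ww' _ j0 jq); lia.
  have Wq i : i \in m2s W -> (i <= q)%N.
    move/mem_m2s; rewrite strip0E; case: eqP => // _.
    by case: (leqP i q) => // /wq ->.
  rewrite sorted_pairwise; last exact: ordle_trans.
  have m2s_pw m : pairwise (@ordle n.+1) (m2s m).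
    by rewrite -sorted_pairwise ?m2s_sorted //; apply: ordle_trans.
  rewrite cat_rcons pairwise_cat pairwise_cons !m2s_pw andbT /=.
  apply/andP; split; last by apply/allP => j /zq.
  apply/allrelP => i j /Wq iq; rewrite inE => /orP [/eqP -> //|/zq].
  exact: leq_trans iq.
- apply/allP => i _ /=; rewrite cat_rcons count_cat /= !count_m2s mnmBE mnmDE mnm1E.
  have := mnm_lepP leW i; rewrite mnmDE mnm1E => ?; apply/eqP; lia.
Qed.

Lemma prodset_strip0 c gs w : (forall g, g \in gs -> Lat c g) ->
  (msum gs <= w)%MM -> exists s, [/\ subseq s (m2s (strip0 w)),
    size s = mdeg (strip0 (msum gs)) &
    prodset (Lat c) (size gs) (U_(ord0) *+ (size gs * c) + s2m s)%MM].
Proof.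
move=> hL le; have [s ss es] := subseq_m2s (strip0_le le).
exists s; split => //.
  rewrite -es -size_m2s; apply: perm_size; apply/allP => i _ /=.
  by rewrite count_m2s s2mE.
rewrite es -(@msum_ord0_eq gs c) ?strip0K; last by move=> g /hL [].
by exists gs.
Qed.

Lemma prodset_exchange N w w' q : prodset L N w -> prodset L N w' ->
  q != ord0 -> (forall j, j != ord0 -> (j < q)%N -> w j = w' j) ->
  (w q < w' q)%N ->
  exists k, [/\ (k == ord0) || (q < k)%N, (0 < w k)%N
    & prodset L N (mswap q k w)].
Proof.
move=> [gs [sz hL ew]] [gs' [sz' hL' ew']] q0 ww' lt.
have lew g k : g \in gs -> (0 < g k)%N -> (0 < w k)%N.
  move=> ggs; rewrite -sub1seq in ggs; have /mnm_lepP/(_ k) := msum_subseq ggs.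
  by rewrite ew /msum big_seq1; lia.
have repl g k : g \in gs -> (k == ord0) || (q < k)%N -> (0 < g k)%N ->
    L (mswap q k g) -> exists k, [/\ (k == ord0) || (q < k)%N, (0 < w k)%N
    & prodset L N (mswap q k w)].
  move=> ggs kq gk Lg'; exists k; split; rewrite ?(lew g) // -sz ew.
  exact: prodset_replace Lg'.
case: (boolP (has (fun g : 'X_{1..n.+1} => b.+1 < g ord0)%N gs)).
  move=> /hasP [g ggs g0]; apply: (repl g ord0) => //; first by lia.
  by apply: L_high => //; apply: hL.
rewrite -all_predC => /allP /= gs_le.
have gsb g : g \in gs -> g ord0 = b \/ g ord0 = b.+1.
  by move=> ggs; have := gs_le _ ggs; have := L_ord0 (hL _ ggs); lia.
case: (boolP (has (fun g : 'X_{1..n.+1} => [exists j : 'I_n.+1, (q < j)%N && (0 < g j)%N]) gs)).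
  move=> /hasP [g ggs /existsP [j /andP [qj gj]]]; have Lg := hL _ ggs.
  case: (gsb _ ggs) => g0.
    apply: (repl g j) => //; first by rewrite qj orbT.
    by apply: L_low => //; rewrite qj andbT lt0n.
  by have [k [k1 k2 k3]] := L_mid Lg g0 q0 qj gj; apply: (repl g k).
rewrite -all_predC => /allP /= gs_q.
have wq j : (q < j)%N -> w j = 0%N.
  move=> qj; apply/eqP; rewrite -leqn0 leqNgt; apply/negP; rewrite ew.
  move=> /msum_gt0 [g /gs_q /negP gq gj]; apply: gq; apply/existsP; exists j.
  by rewrite qj.
have [z ez] := word_prefix q0 wq ww' lt.
set s := rcons _ q in ez.
pose isb g := g ord0 == b.
have cnt := count_predC isb gs; rewrite -!size_filter in cnt.
set gb := [seq x <- gs | isb x] in cnt; set gc := [seq x <- gs | _] in cnt.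
set gb' := [seq x <- gs' | isb x].
have hgb g : g \in gb -> Lat b g.
  by rewrite mem_filter => /andP [/eqP g0 /hL Lg].
have hgc g : g \in gc -> Lat b.+1 g.
  rewrite mem_filter /= /isb => /andP [g0 ggs]; split; first exact: hL.
  by case: (gsb _ ggs) g0 => // ->; rewrite eqxx.
have hgb' g : g \in gb' -> Lat b g.
  by rewrite mem_filter => /andP [/eqP g0 /hL' Lg].
have w0 : w ord0 = (size gb * b + size gc * b.+1)%N.
  rewrite ew /msum (perm_big (gb ++ gc)) /=; last by rewrite perm_sym perm_filterC.
  rewrite -/(msum _) msum_cat mnmDE (@msum_ord0_eq gb b); last by move=> g /hgb [].
  by rewrite (@msum_ord0_eq gc b.+1) // => g /hgc [].
have w'0 := msum_ord0_ge hL'; rewrite -ew' -size_filter -/gb' sz' in w'0.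
have dw : mdeg w = (N * d)%N by apply: prodset_deg; exists gs.
have dw' : mdeg w' = (N * d)%N by apply: prodset_deg; exists gs'.
have ltb : (size gb < size gb')%N.
  have := congr1 size ez; rewrite size_cat size_rcons !size_m2s.
  by have := mdeg_strip0 w; have := mdeg_strip0 w'; nia.
have gc0 : (0 < size gc)%N.
  by have := count_size isb gs'; rewrite -size_filter -/gb' sz'; lia.
pose A1 := take (size gb).+1 gb'; pose A2 := behead gc.
have sA1 : size A1 = (size gb).+1 by rewrite size_takel.
have sA2 : size A2 = (size gc).-1 by rewrite size_behead.
have hA1 g : g \in A1 -> Lat b g by move/mem_take/hgb'.
have hA2 g : g \in A2 -> Lat b.+1 g by move/mem_behead/hgc.
have le1 : (msum A1 <= w')%MM.
  rewrite ew'; apply: msum_subseq; apply: subseq_trans (filter_subseq isb gs').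
  exact: take_subseq.
have le2 : (msum A2 <= w)%MM.
  rewrite ew; apply: msum_subseq; apply: subseq_trans (filter_subseq (predC isb) gs).
  by rewrite /A2 -drop1; apply: drop_subseq.
have [t1 [st1 zt1 Pt1]] := prodset_strip0 hA1 le1.
have [t2 [st2 zt2 Pt2]] := prodset_strip0 hA2 le2.
have szs : size s = (size t1 + size t2)%N.
  have := mdeg_strip0 (msum A1); have := mdeg_strip0 (msum A2).
  rewrite zt1 zt2 (@mdeg_msum _ A1 d); last by move=> g /hA1 [/L_deg].
  rewrite (@mdeg_msum _ A2 d); last by move=> g /hA2 [/L_deg].
  rewrite (@msum_ord0_eq A1 b); last by move=> g /hA1 [].
  rewrite (@msum_ord0_eq A2 b.+1); last by move=> g /hA2 [].
  rewrite /s size_rcons size_m2s; have := mdeg_strip0 w.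
  by rewrite dw -sz -cnt w0 sA1 sA2; case: (size gc) gc0 => // k _ /=; nia.
have word0 m : all (fun i : 'I_n.+1 => 0 < i)%N (m2s (strip0 m)).
  apply/allP => i; rewrite -has_pred1 has_count count_m2s strip0E -val_eqE /=.
  by case: eqP => //=; lia.
have R1 : all2 (fun i j => (0 < i)%N && (i <= j)%N) (take (size t1) s) t1.
  have := subseq_sorted_take (@ordle_refl _) (@ordle_trans _) (m2s_sorted _) st1.
  have -> : take (size t1) (m2s (strip0 w')) = take (size t1) s.
    by rewrite ez takel_cat // szs leq_addr.
  have : all (fun i : 'I_n.+1 => 0 < i)%N (take (size t1) s).
    apply/allP => i /mem_take; rewrite mem_rcons inE => /orP [/eqP ->|].
      by rewrite lt0n.
    exact: (allP (word0 w)).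
  exact: all2_andl.
have R2 : all2 (fun j i => (0 < i)%N && (i <= j)%N) (drop (size t1) s) t2.
  apply: all2_flip.
  have st2' : subseq t2 s by apply: subseq_trans st2 _; apply: subseq_rcons.
  have ss : sorted (@ordle _) s.
    have := m2s_sorted (strip0 w'); rewrite ez sorted_pairwise ?pairwise_cat.
      by move=> /and3P [_ + _]; rewrite -sorted_pairwise //; apply: ordle_trans.
    exact: ordle_trans.
  have := subseq_sorted_drop (@ordle_refl _) (@ordle_trans _) ss st2'.
  rewrite szs addnK.
  have : all (fun i : 'I_n.+1 => 0 < i)%N t2.
    by apply/allP => i /(mem_subseq st2); apply: (allP (word0 w)).
  exact: all2_andl.
have Q1 := moves_all2 (@Lat_low_move (size A1)) R1 Pt1.
have Q2 := moves_all2 (fun i j m => @Lat_mid_move (size A2) i j m) R2 Pt2.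
have /(prodset_mono (L' := L)) Q1' := Q1; have /(prodset_mono (L' := L)) Q2' := Q2.
have := prodsetD (Q1' (fun g h => proj1 h)) (Q2' (fun g h => proj1 h)).
have w0_gt0 : (0 < w ord0)%N by rewrite w0; case: (size gc) gc0 => // k _; rewrite mulSn; lia.
have -> : (size A1 + size A2 = N)%N by rewrite sA1 sA2; lia.
move=> h; exists ord0; split => //.
suff -> : mswap q ord0 w = (U_(ord0) *+ (size A1 * b) + s2m (take (size t1) s) +
   (U_(ord0) *+ (size A2 * b.+1) + s2m (drop (size t1) s)))%MM by [].
apply/mnmP => k; rewrite mswapE !mnmDE !mulmnE !mnm1E.
have := congr1 (fun s => count_mem k s) (cat_take_drop (size t1) s).
have -> : count_mem k s = (strip0 w k + (q == k))%N.
  by rewrite -s2mE /s -cats1 s2m_cat s2mK mnmDE s2mE /= addn0.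
rewrite count_cat -!s2mE strip0E.
rewrite [ord0 == k]eq_sym; case: (k =P ord0) => [->|_]; last by lia.
rewrite sA1 sA2 (negPf q0) w0 /=; case: (size gc) gc0 => // c _ /=.
by nia.
Qed.

End Exchange.

(** * Linear quotients of the powers *)

Definition monos n d : seq 'X_{1..n} :=
  [seq s2m t | t : d.-tuple 'I_n <- enum (basis n d)].

Lemma mem_monos n d (m : 'X_{1..n}) : (m \in monos n d) = (mdeg m == d).
Proof. by rewrite basis_cover. Qed.

Section MonFacts.
Variable n : nat.
Implicit Types m v w x : 'X_{1..n}.

Lemma lem_mdeg_eq m1 m2 : (m1 <= m2)%MM -> mdeg m1 = mdeg m2 -> m1 = m2.
Proof.
move=> le e; have := submK le; have /eqP : mdeg (m2 - m1)%MM = 0%N.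
  by have := congr1 (@mdeg _) (submK le); rewrite mdegD; lia.
by rewrite mdeg_eq0 => /eqP ->; rewrite add0m.
Qed.

Lemma lem_mdeg m1 m2 : (m1 <= m2)%MM -> (mdeg m1 <= mdeg m2)%N.
Proof. by move=> le; rewrite -(submK le) mdegD leq_addl. Qed.

Lemma mdeg_ge2 m i j : i != j -> (m i + m j <= mdeg m)%N.
Proof.
by move=> ij; rewrite mdegE (bigD1 i) //= (bigD1 j) 1?eq_sym //= addnA leq_addr.
Qed.

Lemma mdeg_ge3 m i j k : i != j -> i != k -> j != k ->
  (m i + m j + m k <= mdeg m)%N.
Proof.
move=> ij ik jk; rewrite mdegE (bigD1 i) //= (bigD1 j) 1?eq_sym //=.
by rewrite (bigD1 k) /= ?[k == _]eq_sym ?ik ?jk // !addnA leq_addr.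
Qed.

Lemma lexle_max (s : seq 'X_{1..n}) : s != [::] ->
  exists2 w, w \in s & forall m, m \in s -> lexle m w.
Proof.
elim: s => // x s IH _; case: (eqVneq s [::]) => [->|/IH [w ws wmax]].
  by exists x; rewrite ?mem_head // => m; rewrite inE => /eqP ->; apply: lexle_refl.
have [xw|wx] := orP (lexle_total x w).
  exists w => [|m]; rewrite inE ?ws ?orbT // => /orP [/eqP -> //|/wmax //].
exists x; rewrite ?mem_head // => m; rewrite inE => /orP [/eqP ->|/wmax h].
  exact: lexle_refl.
exact: lexle_trans wx.
Qed.

Lemma lex_pred_exists v x : lexlt x v -> mdeg x = mdeg v ->
  exists w, is_lex_pred v w.
Proof.
move=> xv dx; pose s := [seq m <- monos n (mdeg v) | lexlt m v].
have xs : x \in s by rewrite mem_filter xv mem_monos dx eqxx.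
have [|w] := @lexle_max s; first by apply/eqP => s0; rewrite s0 in xs.
rewrite mem_filter mem_monos => /andP [wv /eqP dw] wmax.
exists w; split => // w' dw' lt; apply: wmax.
by rewrite mem_filter lt mem_monos dw' eqxx.
Qed.

End MonFacts.

Section MaxIndex.
Variable n : nat.
Implicit Types m w : 'X_{1..n.+1}.

Lemma max_index_spec w : w != 0%MM ->
  (0 < w (max_index w))%N /\ forall i : 'I_n.+1, (max_index w < i)%N -> w i = 0%N.
Proof.
move=> w0; have [i0 wi0] : exists i : 'I_n.+1, (0 < w i)%N.
  apply/existsP; apply: contraR w0; rewrite negb_exists => /forallP h.
  by apply/eqP/mnmP => i; rewrite mnm0E; apply/eqP; rewrite -leqn0 leqNgt h.
case: (@arg_maxnP _ i0 (fun i => 0 < w i)%N (fun i : 'I_n.+1 => i : nat) wi0) => k wk kmax.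
have ek : max_index w = k.
  apply: val_inj; rewrite /= inordK; last first.
    by apply: leq_ltn_trans (ltn_ord k); apply/bigmax_leqP => i /kmax.
  by apply/eqP; rewrite eqn_leq leq_bigmax_cond // andbT; apply/bigmax_leqP => i /kmax.
rewrite ek; split => // i ki; apply/eqP; rewrite -leqn0 leqNgt; apply/negP => wi.
by have /= := kmax _ wi; lia.
Qed.

(* Dividing by x_max truncates the sorted word of a monomial. *)
Lemma lexle_div_max m w j : mdeg w = (mdeg m).+1 ->
  lexle (U_(j) + m)%MM w -> lexle m (w - U_(max_index w))%MM.
Proof.
move=> dw; have w0 : w != 0%MM by rewrite -mdeg_eq0 dw.
have [] := max_index_spec w0; move: (max_index w) => l wm wmax; set z := (w - _)%MM.
have ez : (U_(l) + z)%MM = w.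
  by rewrite addmC submK // lep1mP -lt0n.
have dz : mdeg z = mdeg m.
  by have := congr1 (@mdeg _) ez; rewrite mdegD mdeg1 dw => -[].
rewrite !lexleNgt; apply: contra => /lexltP [i eqi lti].
case: (ltnP i (l)) => [imax|maxi]; last first.
  have : (mdeg z < mdeg m)%N; last by rewrite dz ltnn.
  rewrite !mdegE (bigD1 i) //= [X in (_ < X)%N](bigD1 i) //=.
  rewrite -addSn leq_add //; apply: leq_sum => k ki.
  case: (ltngtP k i) => [/eqi -> //|ik|/val_inj e]; last by rewrite e eqxx in ki.
  suff -> : z k = 0%N by [].
  rewrite /z mnmBE wmax //; exact: leq_ltn_trans ik.
have zw (k : 'I_n.+1) : (k <= i)%N -> w k = z k.
  move=> ki; rewrite -ez mnmDE mnm1E; suff -> : l == k = false by [].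
  by rewrite -val_eqE gtn_eqF //; apply: leq_ltn_trans imax.
apply/lexltP; have [ji|ij] := ltnP j i.
  exists j => [k kj|]; rewrite mnmDE mnm1E (zw _ (ltnW _)) //.
  - rewrite eqi; last exact: ltn_trans kj ji.
    by rewrite -val_eqE gtn_eqF.
  - exact: ltn_trans kj ji.
  - by rewrite eqi // eqxx.
exists i => [k ki|]; last by rewrite mnmDE (zw i) //; lia.
rewrite mnmDE mnm1E (zw _ (ltnW ki)) (eqi _ ki) -val_eqE gtn_eqF //.
exact: leq_trans ij.
Qed.

End MaxIndex.

Lemma lexle_first_two n d (g : 'X_{1..n.+1}) a : (0 < n)%N -> mdeg g = d -> g ord0 = a ->
  lexle g (U_(ord0) *+ a + U_(inord 1) *+ (d - a))%MM.
Proof.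
move=> n0 dg g0; rewrite lexleNgt; apply/negP => /lexltP [k eqk].
set x := (_ + _)%MM in eqk *.
have v1 : (inord 1 : 'I_n.+1) = 1%N :> nat by rewrite inordK.
have x0 : x ord0 = a.
  by rewrite !(mnmDE, mulmnE, mnm1E) eqxx -[inord 1 == _]val_eqE /= v1; lia.
have x1 : x (inord 1) = (d - a)%N.
  by rewrite !(mnmDE, mulmnE, mnm1E) eqxx -[ord0 == _]val_eqE /= v1; lia.
have n01 : ord0 != inord 1 :> 'I_n.+1 by rewrite -val_eqE /= v1.
case: (posnP k) => [k0|k0].
  by have -> : k = ord0; [apply: val_inj | rewrite x0 g0 ltnn].
case: (ltngtP k 1) => [|k1|k1]; first by lia.
  have e1 := eqk (inord 1); rewrite v1 x1 in e1.
  have h : (g ord0 + g (inord 1) + g k <= mdeg g)%N.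
    by apply: mdeg_ge3; rewrite -?val_eqE /= ?v1; lia.
  by have := e1 k1; lia.
have -> : k = inord 1 by apply: val_inj; rewrite /= v1.
by have := mdeg_ge2 g n01; rewrite x1; lia.
Qed.

Section Shape.
Variables (n d : nat) (u v : 'X_{1..n.+1}).
Implicit Types (g : 'X_{1..n.+1}) (i j q : 'I_n.+1).
Hypotheses (du : mdeg u = d) (dv : mdeg v = d) (u0 : (0 < u ord0)%N).

Definition linear_shape : Prop :=
  [\/ exists a : nat,
        [/\ (0 < a <= d)%N,
            u = (U_(ord0) *+ a + U_(inord 1) *+ (d - a))%MM
          & v = (U_(ord0) *+ a + U_(ord_max) *+ (d - a))%MM],
      (v ord0 < u ord0 - 1)%N
    | v ord0 = (u ord0 - 1)%N /\
      forall w, is_lex_pred v w ->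
        lexle (U_(ord0) + w - U_(max_index w))%MM u].

Hypothesis shape : linear_shape.

Lemma lexseg_intro g : mdeg g = d -> (v ord0 < g ord0)%N \/ lexle v g ->
  (g ord0 < u ord0)%N \/ lexle g u -> lexseg u v g.
Proof.
by move=> dg h1 h2; split; rewrite ?du //; [case: h2|case: h1] => // /lexlt_ord0/lexltW.
Qed.

Lemma lexseg_ord0 g : lexseg u v g -> (v ord0 <= g ord0)%N.
Proof. by case=> _ _ /lexle_ord0. Qed.

Lemma lexseg_high g q : lexseg u v g -> ((v ord0).+1 < g ord0)%N -> q != ord0 ->
  lexseg u v (mswap q ord0 g).
Proof.
move=> [dg gu vg] g0 q0; have gg : (0 < g ord0)%N by lia.
apply: lexseg_intro; first by rewrite mdeg_mswap ?dg.
  by left; rewrite mswapE (negPf q0) eqxx; lia.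
right; apply: lexle_trans gu; apply/lexltW/mswap_lt => //.
by rewrite lt0n.
Qed.

Lemma lexseg_low g i j : lexseg u v g -> g ord0 = v ord0 -> (0 < i < j)%N ->
  (0 < g j)%N -> lexseg u v (mswap i j g).
Proof.
move=> [dg gu vg] g0 /andP [i0 ij] gj.
have n0 : (0 < n)%N by have := ltn_ord j; lia.
have sg0 : mswap i j g ord0 = g ord0.
  by rewrite mswap_ord0 // -val_eqE /=; lia.
have sd : mdeg (mswap i j g) = d by rewrite mdeg_mswap ?dg.
apply: lexseg_intro => //.
  by right; apply: lexle_trans vg _; apply/lexltW/mswap_gt.
rewrite sg0 g0; case: shape => [[a [_ eu ev]]|ltb|[eb _]]; [right|left|left]; try lia.
rewrite eu; apply: lexle_first_two => //; rewrite sg0 g0 ev.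
by rewrite !(mnmDE, mulmnE, mnm1E) eqxx -[ord_max == _]val_eqE /=; lia.
Qed.

Lemma lexseg_mid_up g i j : lexseg u v g -> g ord0 = (v ord0).+1 ->
  (0 < i < j)%N -> (0 < g i)%N -> lexseg u v (mswap j i g).
Proof.
move=> [dg gu vg] g0 /andP [i0 ij] gi.
apply: lexseg_intro; first by rewrite mdeg_mswap ?dg.
  by left; rewrite mswap_ord0 ?g0 // -val_eqE /=; lia.
by right; apply: lexle_trans gu; apply/lexltW/mswap_lt.
Qed.

Lemma lexseg_mid g q j : lexseg u v g -> g ord0 = (v ord0).+1 -> q != ord0 ->
  (q < j)%N -> (0 < g j)%N ->
  exists k, [/\ (k == ord0) || (q < k)%N, (0 < g k)%N
    & lexseg u v (mswap q k g)].
Proof.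
move=> [dg gu vg] g0 q0 qj gj.
have j0 : j != ord0 by rewrite -val_eqE /=; lia.
have n0 : (0 < n)%N by have := ltn_ord j; move: q0; rewrite -val_eqE /=; lia.
set h := mswap q j g.
have h0 : h ord0 = (v ord0).+1 by rewrite mswap_ord0.
have dh : mdeg h = d by rewrite mdeg_mswap ?dg.
have d0 : (0 < d)%N by rewrite -dh mdegE (bigD1 ord0) //= h0.
have [hu|uh] := boolP (lexle h u).
  exists j; split; rewrite ?qj ?orbT //.
  by apply: lexseg_intro => //; [left; rewrite h0 | right].
rewrite -lexltNge in uh.
case: shape => [[a [_ eu ev]]|ltb|[eb cond]].
- have := lexle_ord0 gu; rewrite g0 eu ev.
  rewrite !(mnmDE, mulmnE, mnm1E) eqxx -[ord_max == _]val_eqE /=.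
  by rewrite -[inord 1 == _]val_eqE /= inordK //; lia.
- by have := lexle_ord0 (lexltW uh); rewrite h0; lia.
exists ord0; split => //; first by lia.
pose z := (h - U_(ord0))%MM.
have hz : (U_(ord0) + z)%MM = h by rewrite addmC submK // lep1mP h0.
have gz : mswap q ord0 g = (U_(j) + z)%MM.
  have ne : q == j = false by rewrite -val_eqE ltn_eqF.
  have ne0 : q == ord0 = false by apply/negbTE.
  have n0j : ord0 == j = false by rewrite eq_sym; apply/negbTE.
  apply/mnmP => k; rewrite mnmDE /z mnmBE /h !mswapE !mnm1E.
  move: gj g0; case: (j =P k) => [<-|_]; rewrite ?ne ?n0j => gj g0; clear -gj g0; lia.
apply: lexseg_intro; first by rewrite mdeg_mswap ?dg //; lia.
  right; rewrite lexleNgt; apply/negP => lt.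
  have dgz : mdeg (U_(j) + z)%MM = d by rewrite -gz mdeg_mswap ?dg //; lia.
  rewrite gz in lt; have [w wp] := lex_pred_exists lt (etrans dgz (esym dv)).
  have [dw wv wmax] := wp.
  have /lexle_div_max : lexle (U_(j) + z)%MM w by apply: wmax; rewrite ?dgz ?dv.
  move=> /(_ _) le; have {}le : lexle z (w - U_(max_index w))%MM.
    by apply: le; rewrite dw dv -dgz mdegD mdeg1.
  have := cond w wp; rewrite -addmBA; last first.
    rewrite lep1mP -lt0n; apply: (proj1 (max_index_spec _)).
    by rewrite -mdeg_eq0 dw dv -lt0n.
  by move=> le2; move: uh; rewrite lexltNge -hz (lexle_trans _ le2) // lexleD2l.
left; rewrite mswapE (negPf q0) eqxx g0 eb; lia.
Qed.

End Shape.

Lemma prodset_lexseg_exchange n d (u v : 'X_{1..n.+1}) N w w' (q : 'I_n.+1) :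
  mdeg u = d -> mdeg v = d -> (0 < u ord0)%N -> linear_shape d u v ->
  prodset (lexseg u v) N w -> prodset (lexseg u v) N w' ->
  q != ord0 -> (forall j, j != ord0 -> (j < q)%N -> w j = w' j) ->
  (w q < w' q)%N ->
  exists k, [/\ (k == ord0) || (q < k)%N, (0 < w k)%N
    & prodset (lexseg u v) N (mswap q k w)].
Proof.
move=> du dv u0 sh; apply: (@prodset_exchange n d (v ord0)).
- by move=> g [-> _ _].
- exact: lexseg_ord0.
- by move=> *; apply: (lexseg_high du) => //; eassumption.
- by move=> *; apply: (lexseg_low du) => //; eassumption.
- by move=> *; apply: (lexseg_mid du) => //; eassumption.
- by move=> *; apply: (lexseg_mid_up du) => //; eassumption.
Qed.

(* The order of the generators is the lexicographic one for
   x_2 > ... > x_n > x_1; in a fixed degree the last variable is irrelevant. *)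
Definition genle n (w w' : 'X_{1..n.+1}) : bool := lexle (strip0 w') (strip0 w).

Lemma exchange_linear_quotients (K : fieldType) n D (T : seq 'X_{1..n.+1})
  (J : {mpoly K[n.+1]} -> Prop) :
  (forall w, w \in T -> mdeg w = D) ->
  (forall w w' (q : 'I_n.+1), w \in T -> w' \in T -> q != ord0 ->
     (forall j : 'I_n.+1, j != ord0 -> (j < q)%N -> w j = w' j) ->
     (w q < w' q)%N ->
     exists k : 'I_n.+1, [/\ (k == ord0) || (q < k)%N, (0 < w k)%N
       & mswap q k w \in T]) ->
  eqideal J (mon_ideal (in_seq T)) -> has_linear_quotients J.
Proof.
move=> degT exch JT; pose s := sort (@genle n) (undup T).
have memT m : (m \in s) = (m \in T) by rewrite mem_sort mem_undup.
have us : uniq s by rewrite sort_uniq undup_uniq.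
have genle_tr : transitive (@genle n).
  by move=> x y z h1 h2; apply: lexle_trans h2 h1.
have ss : sorted (@genle n) s by apply: sort_sorted => x y; apply: lexle_total.
exists s; split; first split => //.
- by move=> p; rewrite JT; apply: eqideal_mon => m; rewrite /in_seq memT.
- move=> m ms /mon_idealX [g gm le]; have gs := mem_rem gm.
  have e : g = m by apply: lem_mdeg_eq => //; rewrite !degT -?memT.
  by move: gm; rewrite /in_seq e mem_rem_uniqF.
move=> i /andP [i0 isz]; set w := nth _ _ _.
have ws : w \in s by apply: mem_nth.
exists [set k | has (fun g => (g <= U_(k) + w)%MM) (take i s)] => p.
rewrite colonP var_idealP; split => h m /h {h}; last first.
  move=> [k]; rewrite inE => /hasP [g gi gk] mk; exists g => //.
  apply: lepm_trans gk _; apply/mnm_lepP => l; rewrite !mnmDE mnm1E.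
  by case: (k =P l) => [<-|_]; lia.
move=> [g gi gm]; have gs := mem_take gi.
have gi' : (index g s < i)%N by rewrite -in_take.
have gw : genle g w.
  rewrite -[g](nth_index 0%MM gs).
  by apply: (sorted_ltn_nth genle_tr 0%MM ss) => //; rewrite inE index_mem.
have ne : g != w.
  by apply/eqP => e; move: gi'; rewrite e /w index_uniq // ltnn.
have lt : lexlt (strip0 w) (strip0 g).
  rewrite /lexlt -/(genle g w) gw andbT; apply: contra ne => /eqP e.
  have := mdeg_strip0 w; have := mdeg_strip0 g.
  rewrite (degT g) -?memT // (degT w) -?memT // e => h1 h2.
  by rewrite -(strip0K w) -(strip0K g) e; apply/eqP; congr (U_(_) *+ _ + _)%MM; lia.
have [q eq ltq] := lexltP _ _ lt.
have q0 : q != ord0 by apply/eqP => e; move: ltq; rewrite !strip0E e eqxx.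
have {}eq j : j != ord0 -> (j < q)%N -> w j = g j.
  by move=> j0 /eq; rewrite !strip0E (negPf j0).
rewrite !strip0E (negPf q0) in ltq.
have [|//|k [kq wk wT]] := exch w g q _ _ q0 eq ltq; rewrite -?memT //.
set w2 := mswap q k w in wT; rewrite -memT in wT.
have lt2 : lexlt (strip0 w) (strip0 w2).
  have nkq : (k == q) = false.
    case/orP: kq => [/eqP ->|kq]; first by rewrite eq_sym; apply/negbTE.
    by rewrite -val_eqE gtn_eqF.
  apply/lexltP; exists q => [j jq|]; rewrite !strip0E ?(negPf q0).
    case: (j =P ord0) => // /eqP j0; rewrite mswapE.
    have -> : (q == j) = false by rewrite -val_eqE gtn_eqF.
    have -> : (k == j) = false; last by rewrite subn0.
    case/orP: kq => [/eqP ->|kq]; first by rewrite eq_sym; apply/negbTE.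
    by rewrite -val_eqE gtn_eqF // (ltn_trans jq).
  by rewrite mswapE eqxx nkq subn0 add1n.
have w2i : w2 \in take i s.
  rewrite in_take // ltnNge; apply/negP => le.
  suff : genle w w2 by rewrite /genle lexleNgt lt2.
  rewrite -[w2](nth_index 0%MM wT).
  apply: (sorted_leq_nth genle_tr (fun x => lexle_refl _) 0%MM ss) => //.
  by rewrite inE index_mem.
exists q; last first.
  have := leq_trans ltq (mnm_lepP gm q).
  by rewrite mnmDE -[X in (X < _)%N]add0n ltn_add2r.
rewrite inE; apply/hasP; exists w2 => //.
by rewrite -(mswapK q wk); apply: lem_addl.
Qed.

Section PowerGens.
Variables (K : fieldType) (n : nat).
Implicit Types (B L : 'X_{1..n} -> Prop) (I J : {mpoly K[n]} -> Prop).

Lemma mon_idealM B B' (p q : {mpoly K[n]}) : mon_ideal B p -> mon_ideal B' q ->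
  mon_ideal (fun m => exists m1 m2, [/\ B m1, B' m2 & m = (m1 + m2)%MM]) (p * q).
Proof.
move=> /mon_idealP hp /mon_idealP hq; apply/mon_idealP => m /msuppM_le.
move=> /allpairsP [[m1 m2] /= [/hp [g1 B1 le1] /hq [g2 B2 le2] ->]].
exists (g1 + g2)%MM; first by exists g1, g2.
by apply/mnm_lepP => i; rewrite !mnmDE leq_add ?(mnm_lepP _).
Qed.

Lemma ideal_pow_mon L N I : eqideal I (mon_ideal L) ->
  eqideal (ideal_pow I N) (mon_ideal (prodset L N)).
Proof.
move=> eI p; split.
  move=> [s [hs ->]]; apply: ideal_gen_sum => x /hs [f [hf ->]].
  apply: ideal_genMl; elim: N f hf {x hs} => [|N IH] f hf.
    rewrite big_ord0 -mpolyX0; apply: mon_ideal_mem; exists [::].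
    by split; rewrite // /msum big_nil.
  rewrite big_ord_recl; have /eI h0 := hf ord0.
  have := mon_idealM h0 (IH _ (fun i => hf (lift ord0 i))).
  move/mon_idealP => h; apply/mon_idealP => m /h [_ [m1 [m2 [L1 [gs [sz hL ->]] ->]]] le].
  exists (m1 + msum gs)%MM => //; exists (m1 :: gs); split => /=.
  - by rewrite sz.
  - by move=> g; rewrite inE => /orP [/eqP ->|/hL].
  - by rewrite msum_cons.
move=> [s [hs ->]]; apply: ideal_gen_sum => x /hs [m [gs [sz hL ->]] ->].
apply: ideal_genMl; apply: ideal_gen_mem.
exists (fun i => 'X_[nth 0%MM gs i]); split.
  by move=> i; apply/eI/mon_ideal_mem/hL/mem_nth; rewrite sz.
rewrite /msum (big_morph _ (@mpolyXD _ _) (mpolyX0 _ _)) (big_nth 0%MM) sz big_mkord.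
by [].
Qed.

Fixpoint prodlist (Ls : seq 'X_{1..n}) N : seq 'X_{1..n} :=
  if N is N'.+1 then [seq (g + m)%MM | g <- Ls, m <- prodlist Ls N'] else [:: 0%MM].

Lemma mem_prodlist Ls N m : m \in prodlist Ls N <-> prodset (in_seq Ls) N m.
Proof.
elim: N m => [|N IH] m /=.
  rewrite inE; split => [/eqP ->|[gs [/size0nil -> _ ->]]]; last by rewrite /msum big_nil.
  by exists [::]; split; rewrite // /msum big_nil.
split=> [/allpairsP [[g x] /= [gL /IH [gs [sz hL ->]] ->]]|].
  exists (g :: gs); split; rewrite /= ?sz ?msum_cons // => y.
  by rewrite inE => /orP [/eqP ->|/hL].
move=> [[|g gs] [//= [sz] hL ->]]; apply/allpairsP; exists (g, msum gs) => /=.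
split; rewrite ?msum_cons //; first by apply: hL; rewrite mem_head.
by apply/IH; exists gs; split => // y ys; apply: hL; rewrite inE ys orbT.
Qed.

End PowerGens.

Definition seglist n (u v : 'X_{1..n}) :=
  [seq g <- monos n (mdeg u) | lexle g u && lexle v g].

Lemma mem_seglist n (u v g : 'X_{1..n}) : in_seq (seglist u v) g <-> lexseg u v g.
Proof.
rewrite /in_seq mem_filter mem_monos; split => [/andP [/andP [h1 h2] /eqP h3] //|].
by move=> [-> -> ->]; rewrite eqxx.
Qed.

Lemma shape_linear_quotients (K : fieldType) (n d : nat) (u v : 'X_{1..n.+1}) N :
  mdeg u = d -> mdeg v = d -> (0 < u ord0)%N -> linear_shape d u v ->
  has_linear_quotients (ideal_pow (mon_ideal (K := K) (lexseg u v)) N).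
Proof.
move=> du dv u0 sh; pose T := prodlist (seglist u v) N.
have memT m : m \in T <-> prodset (lexseg u v) N m.
  by rewrite mem_prodlist; split; apply: prodset_mono => g /mem_seglist.
apply: (@exchange_linear_quotients K n (N * d) T).
- by move=> w /memT /prodset_deg; apply=> g [-> _ _].
- move=> w w' q /memT wT /memT w'T q0 eq lt.
  have [k [h1 h2 /memT h3]] := prodset_lexseg_exchange du dv u0 sh wT w'T q0 eq lt.
  by exists k.
- move=> p; rewrite (ideal_pow_mon N (fun p => iff_refl _)).
  by apply: eqideal_mon => m; rewrite /in_seq memT.
Qed.

(** * Linear quotients give a linear resolution *)

Section LinearModules.
Variables (K : fieldType) (n : nat).
Local Notation S := {mpoly K[n]}.

Lemma pihomogM_homog k e (p q : S) : q \is e.-homog ->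
  pihomog mdeg (k + e) (p * q) = pihomog mdeg k p * q.
Proof.
move=> hq; pose N := maxn (mmeasure mdeg p) k.+1.
have kN : (k < N)%N by rewrite leq_max ltnSn orbT.
rewrite {1}(@pihomog_partitionE _ _ mdeg N p) ?leq_maxl //.
rewrite mulr_suml linear_sum (bigD1 (Ordinal kN)) //= big1 ?addr0.
  by rewrite pihomog_dE // dhomogM // pihomogP.
move=> i ik; apply: (@pihomog_ne0 _ _ _ (i + e)%N).
  by rewrite eqn_add2r; apply: contra ik => /eqP ik; apply/eqP/val_inj.
by rewrite dhomogM // pihomogP.
Qed.

Definition homog_mx e r c (B : 'M[S]_(r, c)) : Prop :=
  forall i j, B i j \is e.-homog.

Definition rowspace r c (B : 'M[S]_(r, c)) (z : 'rV[S]_c) : Prop :=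
  exists y, z = y *m B.

Definition syz r c (B : 'M[S]_(r, c)) (y : 'rV[S]_r) : Prop := y *m B = 0.

Definition hcomp k r c (B : 'M[S]_(r, c)) := map_mx (pihomog mdeg k) B.

(* Z is generated by vectors of linear forms, and so are all its iterated
   syzygy modules. *)
CoInductive lin_module : forall r, ('rV[S]_r -> Prop) -> Prop :=
  LinModule r r' (Z : 'rV[S]_r -> Prop) (Z' : 'rV[S]_r' -> Prop)
    (B : 'M[S]_(r', r)) :
    homog_mx 1 B -> (forall z, Z z <-> rowspace B z) ->
    (forall y, Z' y <-> syz B y) -> lin_module Z' -> lin_module Z.

Lemma lin_moduleE r (Z : 'rV[S]_r -> Prop) : lin_module Z ->
  exists r' (Z' : 'rV[S]_r' -> Prop) (B : 'M[S]_(r', r)),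
    [/\ homog_mx 1 B, forall z, Z z <-> rowspace B z,
        forall y, Z' y <-> syz B y & lin_module Z'].
Proof. by case=> {}r r' {}Z Z' B *; exists r', Z', B. Qed.

Lemma lin_module_ext r (Z1 Z2 : 'rV[S]_r -> Prop) :
  (forall z, Z1 z <-> Z2 z) -> lin_module Z1 -> lin_module Z2.
Proof.
move=> eZ /lin_moduleE [r' [Z' [B [hB eB eZ' L]]]].
by apply: (LinModule hB _ eZ' L) => z; rewrite -eZ.
Qed.

Lemma lin_module0 (Z : 'rV[S]_0 -> Prop) : (forall z, Z z) -> lin_module Z.
Proof.
move: Z; cofix CH => Z hZ.
apply: (@LinModule 0%N 0%N Z (fun _ => True) 0).
- by move=> [].
- by move=> z; split => // _; exists 0; rewrite [z]thinmx0 mulmx0.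
- by move=> y; split => // _; rewrite /syz mulmx0.
- by apply: CH.
Qed.

Definition submod r (Z : 'rV[S]_r -> Prop) : Prop :=
  Z 0 /\ forall c x y, Z x -> Z y -> Z (c *: x + y).

Definition graded r (Z : 'rV[S]_r -> Prop) : Prop :=
  forall k x, Z x -> Z (hcomp k x).

Lemma submod_syz r c (B : 'M[S]_(r, c)) : submod (syz B).
Proof.
split=> [|a x y]; rewrite /syz ?mul0mx // => ex ey.
by rewrite mulmxDl -scalemxAl ex ey scaler0 addr0.
Qed.

Lemma hcompM k e r c p (X : 'M[S]_(p, r)) (B : 'M[S]_(r, c)) : homog_mx e B ->
  hcomp (k + e) (X *m B) = hcomp k X *m B.
Proof.
move=> hB; apply/matrixP => i j; rewrite !mxE linear_sum.
by apply: eq_bigr => l _; rewrite mxE -(pihomogM_homog _ _ (hB l j)).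
Qed.

Lemma hcomp_homog e r c (B : 'M[S]_(r, c)) : homog_mx e B -> hcomp e B = B.
Proof. by move=> hB; apply/matrixP => i j; rewrite mxE pihomog_dE. Qed.

Lemma hcomp0 k r c : hcomp k (0 : 'M[S]_(r, c)) = 0.
Proof. by apply/matrixP => i j; rewrite !mxE pihomog0. Qed.

Lemma graded_syz e r c (B : 'M[S]_(r, c)) : homog_mx e B -> graded (syz B).
Proof. by move=> hB k x; rewrite /syz -(hcompM _ _ hB) => ->; rewrite hcomp0. Qed.

Lemma submod_mul r p (Z : 'rV[S]_r -> Prop) (M : 'M[S]_(p, r)) y :
  submod Z -> (forall i, Z (row i M)) -> Z (y *m M).
Proof.
move=> [Z0 ZD] hM; rewrite mulmx_sum_row; elim/big_ind: _ => //.
  by move=> a b Za Zb; rewrite -[a]scale1r; apply: ZD.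
by move=> i _; rewrite -[_ *: _]addr0; apply: ZD.
Qed.

Definition ses_ok a b (Z : 'rV[S]_(a + b) -> Prop) : Prop :=
  [/\ submod Z, graded Z, lin_module (fun x => Z (row_mx x 0))
    & lin_module (fun y => exists x, Z (row_mx x y))].

(* The horseshoe construction. *)
Lemma ses_ok_step a b (Z : 'rV[S]_(a + b) -> Prop) : ses_ok Z ->
  exists r1 r2 (B : 'M[S]_(r1 + r2, a + b)),
    [/\ homog_mx 1 B, forall z, Z z <-> rowspace B z & ses_ok (syz B)].
Proof.
move=> [subZ grZ].
move=> /lin_moduleE [r1 [Z1 [B1 [h1 e1 s1 L1]]]].
move=> /lin_moduleE [r2 [Z2 [B2 [h2 e2 s2 L2]]]].
have [X [hX ZX]] : exists X : 'M[S]_(r2, a),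
    homog_mx 1 X /\ forall i, Z (row_mx (row i X) (row i B2)).
  have /fin_all_exists [f hf] : forall i, exists x : 'rV[S]_a,
      homog_mx 1 x /\ Z (row_mx x (row i B2)).
    move=> i; have [x Zx] : exists x, Z (row_mx x (row i B2)).
      by apply/e2; exists (delta_mx 0 i); rewrite rowE.
    exists (hcomp 1 x); split; first by move=> k j; rewrite mxE pihomogP.
    have <- : hcomp 1 (row i B2) = row i B2.
      by rewrite hcomp_homog // => k j; rewrite mxE.
    by rewrite /hcomp -map_row_mx; apply: grZ.
  exists (\matrix_(i, j) f i 0 j); split.
    by move=> i j; rewrite mxE; have [+ _] := hf i; apply.
  move=> i; have [_] := hf i; congr Z; congr row_mx.
  by apply/rowP => j; rewrite !mxE.
have ZXM y : Z (row_mx (y *m X) (y *m B2)).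
  rewrite -mul_mx_row; apply: submod_mul => // i.
  by rewrite row_row_mx.
have mulB y1 y2 : row_mx y1 y2 *m block_mx B1 0 X B2 =
    row_mx (y1 *m B1 + y2 *m X) (y2 *m B2).
  by rewrite mul_row_block mulmx0 add0r.
have hB : homog_mx 1 (block_mx B1 0 X B2).
  move=> i j; rewrite -[i]splitK -[j]splitK.
  case: (split i) => i'; case: (split j) => j' /=.
  - by rewrite block_mxEul.
  - by rewrite block_mxEur mxE rpred0.
  - by rewrite block_mxEdl.
  - by rewrite block_mxEdr.
have [Z0 ZD] := subZ.
exists r1, r2, (block_mx B1 0 X B2); split => //.
- move=> z; split; last first.
    move=> [y ->]; rewrite -(hsubmxK y) mulB.
    set y1 := lsubmx y; set y2 := rsubmx y.
    have -> : row_mx (y1 *m B1 + y2 *m X) (y2 *m B2) =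
       1 *: row_mx (y1 *m B1) 0 + row_mx (y2 *m X) (y2 *m B2).
      by rewrite scale1r add_row_mx add0r.
    by apply: ZD => //; apply/e1; exists y1.
  move=> Zz; have [y2 ey2] : rowspace B2 (rsubmx z).
    by apply/e2; exists (lsubmx z); rewrite hsubmxK.
  have [y1 ey1] : rowspace B1 (lsubmx z - y2 *m X).
    apply/e1; have := ZD (-1) _ _ (ZXM y2) Zz.
    by rewrite -{1}(hsubmxK z) scaleN1r opp_row_mx add_row_mx ey2 addNr addrC.
  exists (row_mx y1 y2); rewrite mulB -ey1 subrK -ey2 hsubmxK //.
- split; [exact: submod_syz | exact: graded_syz hB | |].
    apply: lin_module_ext L1 => y; rewrite s1 /syz mulB !mul0mx addr0.
    by split => [->|]; rewrite ?row_mx0 // => /eqP; rewrite row_mx_eq0 => /andP [/eqP].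
  apply: lin_module_ext L2 => y; rewrite s2 /syz; split.
    move=> ey; have [y1 ey1] : rowspace B1 (y *m X).
      by apply/e1; have := ZXM y; rewrite ey.
    by exists (- y1); rewrite mulB ey mulNmx -ey1 addNr row_mx0.
  by move=> [x /eqP]; rewrite mulB row_mx_eq0 => /andP [_ /eqP].
Qed.

Lemma lin_module_ses a b (Z : 'rV[S]_(a + b) -> Prop) : ses_ok Z -> lin_module Z.
Proof.
move: a b Z; cofix CH => a b Z /ses_ok_step [r1 [r2 [B [hB eB okB]]]].
exact: (LinModule hB eB (fun y => iff_refl _) (CH _ _ _ okB)).
Qed.

Definition lin_ideal e (J : S -> Prop) : Prop :=
  exists m (A : 'cV[S]_m), [/\ homog_mx e A,
    forall p, J p <-> exists x : 'rV[S]_m, p = (x *m A) 0 0 & lin_module (syz A)].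

Lemma lin_ideal_ext e J J' : eqideal J J' -> lin_ideal e J -> lin_ideal e J'.
Proof.
by move=> eJ [m [A [hA eA L]]]; exists m, A; split => // p; rewrite -eJ.
Qed.

Lemma lin_ideal0 e J : (forall p, J p <-> p = 0) -> lin_ideal e J.
Proof.
move=> J0; exists 0%N, 0; split => [[]//|p|].
  rewrite J0; split => [->|[x ->]]; last by rewrite mulmx0 mxE.
  by exists 0; rewrite mulmx0 mxE.
by apply: lin_module0 => z; rewrite /syz mulmx0.
Qed.

Lemma lin_ideal_module J : lin_ideal 1 J ->
  lin_module (fun y : 'rV[S]_1 => J (y 0 0)).
Proof.
move=> [m [A [hA eA L]]]; apply: (LinModule hA _ (fun y => iff_refl _) L) => z.
rewrite eA; split=> -[x ex]; exists x; last by rewrite ex.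
by rewrite [z]mx11_scalar ex -mx11_scalar.
Qed.

Lemma lin_ideal_add e J J' w : lin_ideal e J -> w \is e.-homog ->
  (forall p, J' p <-> exists j c, J j /\ p = j + c * w) ->
  lin_module (fun y : 'rV[S]_1 => J (y 0 0 * w)) -> lin_ideal e J'.
Proof.
move=> [m [A [hA eA L]]] hw eJ' Lw; exists (m + 1)%N, (col_mx A w%:M).
have hB : homog_mx e (col_mx A w%:M).
  move=> i j; rewrite -[i]splitK; case: (split i) => i' /=.
    by rewrite col_mxEu.
  by rewrite col_mxEd mxE !ord1 eqxx.
have mulB (x : 'rV_m) (y : 'rV_1) :
    (row_mx x y *m col_mx A w%:M) = (x *m A + (y 0 0 * w)%:M)%R.
  by rewrite mul_row_col mul_mx_scalar [y in _ *: y]mx11_scalar scale_scalar_mx mulrC.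
split => //.
  move=> p; rewrite eJ'; split.
    move=> [j [c [/eA [x ->] ->]]]; exists (row_mx x c%:M).
    by rewrite mulB !mxE eqxx.
  move=> [x ->]; exists ((lsubmx x *m A) 0 0), (rsubmx x 0 0); split.
    by apply/eA; exists (lsubmx x).
  by rewrite -{1}(hsubmxK x) mulB !mxE eqxx.
apply: lin_module_ses; split; [exact: submod_syz | exact: graded_syz hB | |].
  apply: lin_module_ext L => y; rewrite /syz mulB mxE mul0r.
  by rewrite (_ : 0%:M = 0) ?addr0 //; apply/matrixP => i j; rewrite !mxE mul0rn.
apply: lin_module_ext Lw => y; rewrite eA /syz; split.
  move=> [x ex]; exists (- x); rewrite mulB ex mulNmx -mx11_scalar addNr //.
move=> [x]; rewrite mulB => ex; exists (- x).
have := congr1 (fun M : 'M_1 => M 0 0) ex; rewrite mulNmx !mxE eqxx mulr1n => /eqP.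
by rewrite addrC addr_eq0 => /eqP.
Qed.

Lemma ideal_gen_ind (G P : S -> Prop) : P 0 ->
  (forall p q, P p -> P q -> P (p + q)) -> (forall r g, G g -> P (r * g)) ->
  forall p, ideal_gen G p -> P p.
Proof.
move=> P0 PD PM p [s [hs ->]]; rewrite big_seq; elim/big_ind: _ => //.
by move=> x /hs; apply: PM.
Qed.

Lemma mon_ideal_add (B B' : 'X_{1..n} -> Prop) w p :
  (forall m, B' m <-> B m \/ m = w) ->
  mon_ideal (K := K) B' p <-> exists j c, mon_ideal B j /\ p = j + c * 'X_[w].
Proof.
move=> eB; split; last first.
  move=> [j [c [hj ->]]]; apply: ideal_genD; last first.
    by apply/ideal_genMl/mon_ideal_mem/eB; right.
  move: hj; rewrite -!/(mon_ideal _ _) !mon_idealP => h m /h [g Bg gm].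
  by exists g => //; apply/eB; left.
move: p; apply: ideal_gen_ind.
- by exists 0, 0; split; [apply: ideal_gen0 | rewrite mul0r addr0].
- move=> _ _ [j1 [c1 [h1 ->]]] [j2 [c2 [h2 ->]]]; exists (j1 + j2), (c1 + c2).
  by split; [apply: ideal_genD | rewrite mulrDl addrACA].
- move=> r _ [m /eB [Bm|->] ->].
    exists (r * 'X_[m]), 0; rewrite mul0r addr0; split => //.
    exact/ideal_genMl/mon_ideal_mem.
  by exists 0, r; rewrite add0r; split => //; apply: ideal_gen0.
Qed.

Lemma var_ideal_lin (A : {set 'I_n}) : lin_ideal 1 (var_ideal (K := K) A).
Proof.
move: {2}#|A| (erefl #|A|) => k; elim: k A => [|k IH] A cA.
  apply: lin_ideal0 => p; have -> : A = set0 by apply/eqP; rewrite -cards_eq0 cA.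
  split => [/var_idealP h|->]; last exact: ideal_gen0.
  apply/eqP; rewrite -msupp_eq0; case e: (msupp p) => [//|m s].
  by have [i] := h m (eq_ind_r (fun s => is_true (m \in s)) (mem_head _ _) e); rewrite inE.
have [a aA] : exists a, a \in A by apply/card_gt0P; rewrite cA.
have cA' : #|A :\ a| = k by move: cA; rewrite (cardsD1 a) aA => -[].
have IHa := IH _ cA'.
apply: (lin_ideal_add (w := 'X_a) IHa).
- by rewrite dhomogX /= mdeg1.
- move=> p; rewrite var_idealE.
  rewrite (@mon_ideal_add (fun m => exists2 i, i \in A :\ a & m = U_(i)%MM) _ U_(a)%MM).
    by split=> -[j [c [h ->]]]; exists j, c; split => //; apply/var_idealE.
  move=> m; split => [[i iA ->]|[[i /setD1P [_ iA] ->]|->]].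
  + by case: (i =P a) => [->|/eqP ia]; [right | left; exists i; rewrite ?inE ?ia].
  + by exists i.
  + by exists a.
- apply: lin_module_ext (lin_ideal_module IHa) => y; rewrite !var_idealP.
  split => h m; last first.
    move=> my; have [|i /setD1P [ia iA]] := h (U_(a) + m)%MM.
      by rewrite (perm_mem (msuppMX _ _)); apply/mapP; exists m.
    rewrite mnmDE mnm1E eq_sym (negPf ia) add0n => mi.
    by exists i => //; rewrite !inE ia.
  rewrite (perm_mem (msuppMX _ _)) => /mapP [m' /h [i iA mi] ->].
  by exists i => //; rewrite mnmDE addn_gt0 mi orbT.
Qed.

Lemma linear_quotients_lin_ideal e (s : seq 'X_{1..n}) J :
  (forall m, m \in s -> mdeg m = e) -> eqideal J (mon_ideal (in_seq s)) ->
  (forall i, (0 < i < size s)%N -> exists A : {set 'I_n},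
    eqideal (colon (mon_ideal (in_seq (take i s))) 'X_[nth 0%MM s i])
            (var_ideal (K := K) A)) ->
  lin_ideal e J.
Proof.
move=> hs eJ hq.
suff h k : (k <= size s)%N -> lin_ideal e (mon_ideal (in_seq (take k s))).
  have := h _ (leqnn _); rewrite take_size; apply: lin_ideal_ext => p.
  by rewrite eJ.
elim: k => [|k IH] ks.
  rewrite take0; apply: lin_ideal0 => p; split => [|->]; last exact: ideal_gen0.
  move=> h; apply: (ideal_gen_ind (P := fun p => p = 0) _ _ _ h) => //.
    by move=> ? ? -> ->; rewrite addr0.
  by move=> ? ? [].
apply: (lin_ideal_add (w := 'X_[nth 0%MM s k]) (IH (ltnW ks))).
- by rewrite dhomogX /= hs ?mem_nth.
- move=> p; apply: mon_ideal_add => m; rewrite /in_seq (take_nth 0%MM) //.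
  rewrite mem_rcons inE; split => [/orP [/eqP|]|[|->]]; try by [right|left].
    by move=> ->; rewrite orbT.
  by rewrite eqxx.
have [A eA] : exists A : {set 'I_n},
    eqideal (colon (mon_ideal (in_seq (take k s))) 'X_[nth 0%MM s k]) (var_ideal (K := K) A).
  case: (posnP k) => [->|k0]; last by apply: hq; rewrite k0.
  exists set0 => p; rewrite take0 colonP var_idealP.
  by split => h m /h [] // i; rewrite inE.
by apply: lin_module_ext (lin_ideal_module (var_ideal_lin A)) => y; rewrite -eA.
Qed.

End LinearModules.

Section BuildResolution.
Variables (K : fieldType) (n : nat).
Local Notation S := {mpoly K[n]}.

Definition lin_state := {r : nat & {Z : 'rV[S]_r -> Prop | lin_module Z}}.
Definition st_rank (t : lin_state) : nat := projT1 t.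
Definition st_mod (t : lin_state) : 'rV[S]_(st_rank t) -> Prop := proj1_sig (projT2 t).

Definition lin_step (t : lin_state) (x : {t' : lin_state & 'M[S]_(st_rank t', st_rank t)}) : Prop :=
  let B := projT2 x in
  [/\ homog_mx 1 B, forall z, st_mod z <-> rowspace B z
    & forall y : 'rV[S]_(st_rank (projT1 x)), st_mod y <-> syz B y].

Lemma lin_step_ex t : exists x, @lin_step t x.
Proof.
case: t => r [Z L]; have [r' [Z' [B [h1 h2 h3 L']]]] := lin_moduleE L.
by exists (existT _ (existT _ r' (exist _ Z' L') : lin_state) B).
Qed.

Definition lin_next t := proj1_sig
  (ClassicalEpsilon.constructive_indefinite_description _ (lin_step_ex t)).

Lemma lin_nextP t : lin_step (lin_next t).
Proof. exact: proj2_sig. Qed.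

Lemma lin_ideal_resolution e (J : S -> Prop) : lin_ideal e J ->
  has_linear_resolution J.
Proof.
move=> [m [A [hA eA L]]]; exists e; split.
  exists [seq A j 0 | j <- enum 'I_m]; first by move=> f /mapP [j _ ->].
  move=> p; rewrite eA; split => [[x ->]|].
    rewrite mxE -big_enum /=; apply: ideal_gen_sum => j _.
    by apply/ideal_genMl/ideal_gen_mem/map_f; rewrite mem_enum.
  move: p; apply: ideal_gen_ind.
  - by exists 0; rewrite mul0mx mxE.
  - by move=> _ _ [x ->] [y ->]; exists (x + y); rewrite mulmxDl [RHS]mxE.
  - move=> r f; rewrite /in_seq => /mapP [j _ ->]; exists (r *: delta_mx 0 j).
    by rewrite -scalemxAl -rowE !mxE.
pose t0 : lin_state := existT _ m (exist _ (syz A) L).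
pose st := fix st i := if i is i'.+1 then projT1 (lin_next (st i')) else t0.
pose B i : 'M[S]_(st_rank (st i.+1), st_rank (st i)) := projT2 (lin_next (st i)).
have hB i : homog_mx 1 (B i) by have [] := lin_nextP (st i).
have B1 i z : @st_mod (st i) z <-> rowspace (B i) z by have [_ + _] := lin_nextP (st i).
have B2 i y : @st_mod (st i.+1) y <-> syz (B i) y by have [_ _] := lin_nextP (st i).
have F : { F : graded_free_resolution J |
   gfr_linear e F /\ forall i (j : 'I_(gfr_rank F i.+1)) k, gfr_diff F i j k \is 1.-homog }.
  unshelve eexists.
    unshelve refine (@GradedFreeResolution K n J (fun i => st_rank (st i))
      (fun i _ => (e + i)%N%:Z) A B _ _ _ _ _).
    + by move=> j x /(dhomogP _ _ _ (hA j 0)) ->; rewrite addn0.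
    + move=> i j k x /(dhomogP _ _ _ (hB i j k)) ->.
      by rewrite addnS; lia.
    + exact: eA.
    + exact: (B1 0%N).
    + by move=> i x; apply: iff_trans (iff_sym (B2 i x)) (B1 i.+1 x).
  by split=> //; apply: hB.
case: F => F [lF hF]; exists F; split => // i j k.
apply/var_idealP => x /(dhomogP _ _ _ (hF i j k)) /eqP.
rewrite mdeg_eq1 => /existsP [l /eqP ->]; exists l; rewrite ?inE //.
by rewrite mnm1E eqxx.
Qed.

End BuildResolution.

Lemma linear_quotients_resolution (K : fieldType) n e (B : 'X_{1..n} -> Prop)
  (J : {mpoly K[n]} -> Prop) : (forall m, B m -> mdeg m = e) ->
  eqideal J (mon_ideal B) -> has_linear_quotients J -> has_linear_resolution J.
Proof.
move=> hB eJ [s [[us eJs ms] hq]].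
apply: (@lin_ideal_resolution K n e).
apply: (linear_quotients_lin_ideal _ eJs hq) => m sm.
have /eJs/eJ/mon_idealX [t Bt tm] : mon_ideal (K := K) (in_seq s) 'X_[m].
  exact: mon_ideal_mem.
have /eJ/eJs/mon_idealX [m' sm' m't] : mon_ideal (K := K) B 'X_[t].
  exact: mon_ideal_mem.
have [e'|ne] := eqVneq m' m.
  rewrite e' in m't; rewrite -(hB _ Bt); apply/eqP; rewrite eqn_leq.
  by rewrite !lem_mdeg.
case: (ms _ sm); apply/mon_idealX; exists m'; last exact: lepm_trans tm.
by rewrite /in_seq mem_rem_uniq // inE ne.
Qed.

(** * Hilbert functions *)

Section GradedMap.
Variables (K : fieldType) (n : nat).
Local Notation S := {mpoly K[n.+1]}.
Local Notation V := (dhomog n.+1 K).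

Definition vrow r k (f : {ffun 'I_r -> V k}) : 'rV[S]_r := \row_i val (f i).

(* the component from degree k to degree l of the map given by B *)
Definition gmap r c (B : 'M[S]_(r, c)) k l (f : {ffun 'I_r -> V k}) :
    {ffun 'I_c -> V l} :=
  [ffun j => DHomog (pihomogP mdeg l ((vrow f *m B) 0 j))].

Lemma gmap_is_linear r c (B : 'M[S]_(r, c)) k l : linear (@gmap r c B k l).
Proof.
move=> a f g; apply/ffunP => j; rewrite !ffunE; apply/val_inj => /=.
rewrite -linearP /=; congr (pihomog _ _ _).
have -> : vrow (a *: f + g) = a%:MP *: vrow f + vrow g.
  by apply/rowP => i; rewrite !mxE !ffunE /= -mul_mpolyC.
by rewrite mulmxDl -scalemxAl !mxE mul_mpolyC.
Qed.

HB.instance Definition _ r c B k l :=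
  GRing.isLinear.Build K {ffun 'I_r -> V k} {ffun 'I_c -> V l} _ (@gmap r c B k l)
    (@gmap_is_linear r c B k l).

Definition lmap r c (B : 'M[S]_(r, c)) k l := linfun (@gmap r c B k l).

Lemma vrow_inj r k : injective (@vrow r k).
Proof.
by move=> f g /rowP e; apply/ffunP => i; apply/val_inj; have := e i; rewrite !mxE.
Qed.

Lemma vrow_homog r k (f : {ffun 'I_r -> V k}) : homog_mx k (vrow f).
Proof. by move=> i j; rewrite mxE; case: (f j). Qed.

Lemma vrowE r k (x : 'rV[S]_r) :
  vrow [ffun i => DHomog (pihomogP mdeg k (x 0 i))] = hcomp k x.
Proof. by apply/rowP => i; rewrite !mxE ffunE. Qed.

Lemma vrow_lmap r c (B : 'M[S]_(r, c)) k l e f : homog_mx e B -> l = (k + e)%N ->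
  vrow (lmap B k l f) = vrow f *m B.
Proof.
move=> hB ->; rewrite lfunE /= /gmap vrowE (hcompM _ _ hB) hcomp_homog //.
exact: vrow_homog.
Qed.

Lemma vrow0 r k : vrow (0 : {ffun 'I_r -> V k}) = 0.
Proof. by apply/rowP => i; rewrite !mxE ffunE. Qed.

Lemma lmap_ker r c (B : 'M[S]_(r, c)) k l e f : homog_mx e B -> l = (k + e)%N ->
  (f \in lker (lmap B k l)) = (vrow f *m B == 0).
Proof.
move=> hB el; rewrite memv_ker -(vrow_lmap _ hB el) -(vrow0 c l).
by rewrite (inj_eq (@vrow_inj _ _)).
Qed.

Lemma lmap_rank r c (B : 'M[S]_(r, c)) k l :
  (\dim (lker (lmap B k l)) + \dim (limg (lmap B k l)) = r * 'C(k + n, k))%N.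
Proof.
by have := limg_ker_dim (lmap B k l) fullv; rewrite capfv dimvf /dim /= card_ord.
Qed.

Lemma lmap_exact p r c (B : 'M[S]_(p, r)) (C : 'M[S]_(r, c)) e k l :
  l = (k.+1 + e)%N -> homog_mx 1 B -> homog_mx e C ->
  (forall x : 'rV[S]_r, x *m C = 0 <-> exists y, x = y *m B) ->
  lker (lmap C k.+1 l) = limg (lmap B k k.+1).
Proof.
move=> el hB hC ex; apply/vspaceP => f.
rewrite (lmap_ker _ hC el); apply/eqP/memv_imgP => [/ex [y ey]|[g _ ->]].
  exists [ffun i => DHomog (pihomogP mdeg k (y 0 i))]; rewrite ?memvf //.
  apply: vrow_inj; rewrite (vrow_lmap _ hB) ?addn1 // vrowE -(hcompM _ _ hB) -ey.
  by rewrite addn1 hcomp_homog //; apply: vrow_homog.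
by rewrite (vrow_lmap _ hB) ?addn1 //; apply/ex; exists (vrow g).
Qed.

Lemma lmap_exact0 p r c (B : 'M[S]_(p, r)) (C : 'M[S]_(r, c)) e :
  homog_mx 1 B -> homog_mx e C ->
  (forall x : 'rV[S]_r, x *m C = 0 <-> exists y, x = y *m B) ->
  lker (lmap C 0 e) = 0%VS.
Proof.
move=> hB hC ex; apply/eqP; rewrite -subv0; apply/subvP => f.
rewrite (lmap_ker _ hC) // memv0 => /eqP/ex [y ey].
apply/eqP/vrow_inj; rewrite vrow0 ey; apply/rowP => j; rewrite [RHS]mxE.
have hj : (y *m B) 0 j \is 0.-homog by rewrite -ey; apply: vrow_homog.
apply/eqP; rewrite -msupp_eq0; case em: (msupp _) => [//|m s].
have ms : m \in msupp ((y *m B) 0 j) by rewrite em mem_head.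
have := dhomogP _ _ _ hj _ ms; move: ms; rewrite mxE => /msupp_sum_le.
move=> /flattenP [t /mapP [i _ ->]] /msuppM_le /allpairsP [[m1 m2] /= [_ h ->]].
by rewrite mdegD (dhomogP _ _ _ (hB i j) _ h) addn1.
Qed.

Lemma lmap_img r (A : 'cV[S]_r) (J : S -> Prop) e k (f : {ffun 'I_1 -> V (k + e)}) :
  homog_mx e A -> (forall p, J p <-> exists x : 'rV[S]_r, p = (x *m A) 0 0) ->
  f \in limg (lmap A k (k + e)) <-> J (val (f 0)).
Proof.
move=> hA eJ; have vf : val (f 0) = vrow f 0 0 by rewrite mxE.
split=> [/memv_imgP [g _ ef]|].
  by apply/eJ; exists (vrow g); rewrite -(vrow_lmap _ hA erefl) -ef.
rewrite vf => /eJ [x ex]; apply/memv_imgP.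
exists [ffun i => DHomog (pihomogP mdeg k (x 0 i))]; rewrite ?memvf //.
apply: vrow_inj; rewrite (vrow_lmap _ hA erefl) vrowE -(hcompM _ _ hA).
rewrite -[LHS](hcomp_homog (@vrow_homog _ _ f)); congr (hcomp _ _).
by apply/rowP => i; rewrite ord1 ex.
Qed.

Definition tmon l (m : 'X_{1..n.+1}) : {ffun 'I_1 -> V l} :=
  [ffun _ => DHomog (pihomogP mdeg l 'X_[m])].

Lemma lmap_img_dim r (A : 'cV[S]_r) (J : S -> Prop) e k Ms :
  homog_mx e A -> (forall p, J p <-> exists x : 'rV[S]_r, p = (x *m A) 0 0) ->
  (forall p, J p -> forall m, m \in msupp p -> J 'X_[m]) ->
  uniq Ms -> (forall m, m \in Ms <-> mdeg m = (k + e)%N /\ J 'X_[m]) ->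
  \dim (limg (lmap A k (k + e))) = size Ms.
Proof.
move=> hA eJ monJ uM memM; pose T := [seq tmon (k + e) m | m <- Ms].
have tE m : m \in Ms -> val (tmon (k + e) m 0) = 'X_[m].
  by move=> /memM [dm _]; rewrite ffunE /= pihomogX /= dm eqxx.
rewrite -(size_map (tmon (k + e)) Ms) -/T.
apply: (@vector.size_basis _ _ _ _ (in_tuple T)); rewrite /basis_of; apply/andP; split.
  apply/eqP/vspaceP => f; apply/idP/idP => [|/(lmap_img _ hA eJ) Jf].
    move/coord_span => ->; apply: memv_suml => i _; apply: memvZ.
    have : (in_tuple T)`_i \in T by apply: mem_nth.
    by move=> /mapP [m mM ->]; apply/(lmap_img _ hA eJ); rewrite tE //; case/memM: mM.
  have -> : f = \sum_(m <- msupp (val (f 0))) (val (f 0))@_m *: tmon (k + e) m.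
    apply/ffunP => i; rewrite ord1; apply/val_inj.
    rewrite sum_ffunE linear_sum /= {1}(mpolyE (val (f 0))) !big_seq.
    apply: eq_bigr => m mf; rewrite ffunE /= tE //; apply/memM; split; last exact: monJ mf.
    by apply: (dhomogP _ _ _ _ _ mf); case: (f 0).
  rewrite big_seq; apply: memv_suml => m mf; apply/memvZ/memv_span/map_f/memM.
  split; last exact: monJ mf.
  by apply: (dhomogP _ _ _ _ _ mf); case: (f 0).
apply/freeP => c c0 i.
have iM : (i < size Ms)%N by have := ltn_ord i; rewrite {2}size_map.
have := congr1 (fun f : {ffun 'I_1 -> V (k + e)} => (val (f 0))@_(nth 0%MM Ms i)) c0.
rewrite sum_ffunE linear_sum linear_sum ffunE /= mcoeff0 => <-.
rewrite (bigD1 i) //= big1 ?addr0 => [|j ji].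
  by rewrite ffunE /= mcoeffZ (nth_map 0%MM) // tE ?mem_nth // mcoeffX eqxx mulr1.
have jM : (j < size Ms)%N by have := ltn_ord j; rewrite {2}size_map.
rewrite ffunE /= mcoeffZ (nth_map 0%MM) // tE ?mem_nth // mcoeffX.
by rewrite nth_uniq // -[_ == _ :> nat]/(j == i) (negPf ji) mulr0.
Qed.

End GradedMap.

Section Differences.

Definition fdiff (f : nat -> int) t : int := f t.+1 - f t.

Lemma eq_fdiff N f g t : (forall x, (t <= x <= t + N)%N -> f x = g x) ->
  iter N fdiff f t = iter N fdiff g t.
Proof.
elim: N t => [|N IH] t h /=; first by apply: h; rewrite addn0 leqnn.
by rewrite /fdiff !IH // => x hx; apply: h; lia.
Qed.

Lemma fdiffD N f g t :
  iter N fdiff (fun x => f x + g x) t = iter N fdiff f t + iter N fdiff g t.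
Proof.
by elim: N t => //= N IH t; rewrite /fdiff !IH opprD addrACA.
Qed.

Lemma fdiffZ N c f t : iter N fdiff (fun x => c * f x) t = c * iter N fdiff f t.
Proof. by elim: N t => //= N IH t; rewrite /fdiff !IH mulrBr. Qed.

Lemma fdiff_sum N m (F : 'I_m -> nat -> int) t :
  iter N fdiff (fun x => \sum_(i < m) F i x) t = \sum_(i < m) iter N fdiff (F i) t.
Proof.
elim: N t => //= N IH t; rewrite /fdiff !IH sumrB //.
Qed.

Lemma fdiff_bin N c r t : iter N fdiff (fun x => 'C(c + x, r)%:Z) t =
  if (N <= r)%N then 'C(c + t, r - N)%:Z else 0.
Proof.
elim: N t => [|N IH] t /=; first by rewrite subn0.
rewrite /fdiff !IH; case: (ltngtP N r) => [Nr|_|->]; last by rewrite subnn !bin0.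
  have -> : (r - N = (r - N.+1).+1)%N by lia.
  by rewrite addnS binS; lia.
by rewrite subr0.
Qed.

Lemma fdiff_last N f t : (forall x, (t <= x < t + N)%N -> f x = 0) ->
  iter N fdiff f t = f (t + N)%N.
Proof.
elim: N t => [|N IH] t h /=; first by rewrite addn0.
rewrite /fdiff !IH; first by rewrite (h (t + N)%N) ?subr0 ?addSnnS //; lia.
  by move=> x hx; apply: h; lia.
by move=> x hx; apply: h; lia.
Qed.

Lemma fdiff_first N f : (forall x, (0 < x)%N -> f x = 0) ->
  iter N fdiff f 0%N = (-1) ^+ N * f 0%N.
Proof.
move=> h; suff [//] : iter N fdiff f 0%N = (-1) ^+ N * f 0%N /\
  forall x, (0 < x)%N -> iter N fdiff f x = 0.
elim: N => [|N [IH0 IH]] /=; first by rewrite mul1r.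
split=> [|x x0]; rewrite /fdiff; last by rewrite !IH.
by rewrite IH // IH0 exprS sub0r mulN1r mulNr.
Qed.

Lemma alternating_recurrence (f : nat -> nat -> int) (b s : nat -> int) :
  (forall i, f i 0%N = 0) ->
  (forall i t, f i t.+1 + f i.+1 t = b i * s t) ->
  forall i t, f i t = \sum_(j < t) (-1) ^+ j * b (i + j)%N * s (t - j.+1)%N.
Proof.
move=> f0 fS i t; elim: t i => [|t IH] i; first by rewrite big_ord0 f0.
have := fS i t; rewrite IH big_ord_recl expr0 mul1r addn0 subn1 /= => <-.
rewrite addrAC -addrA -big_split /= big1 ?addr0 // => j _.
by rewrite /bump leq0n add1n addnS addSn subSS exprS; lia.
Qed.

(* Only the term j = n survives: up to t = n + 1, each of the others agrees with
   a binomial polynomial of degree n in t. *)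
Lemma fdiff_alternating n (b : nat -> int) f :
  (forall t, f t = \sum_(j < t) (-1) ^+ j * b j * 'C(t - j.+1 + n, t - j.+1)%:Z) ->
  iter n.+1 fdiff f 0%N = (-1) ^+ n * b n.
Proof.
move=> ef.
pose G (j : 'I_n.+1) t := ((-1) ^+ j * b j) *
  (if (j < t)%N then 'C(t - j.+1 + n, t - j.+1)%:Z else 0).
rewrite (@eq_fdiff _ _ (fun t => \sum_j G j t)); last first.
  move=> t /andP [_ tn]; rewrite ef /G.
  rewrite (big_ord_widen n.+1 (fun j => (-1) ^+ j * b j * 'C(t - j.+1 + n, t - j.+1)%:Z)) //.
  by rewrite big_mkcond; apply: eq_bigr => j _; case: ifP; rewrite ?mulr0.
pose H j t : int := if (j < t)%N then 'C(t - j.+1 + n, t - j.+1)%:Z else 0.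
have GH (j : 'I_n.+1) : iter n.+1 fdiff (G j) 0%N = (-1) ^+ j * b j * iter n.+1 fdiff (H j) 0%N.
  exact: (fdiffZ _ _ (H j)).
rewrite fdiff_sum (bigD1 ord_max) // big1 => [|j jn]; rewrite GH.
  rewrite fdiff_last ?add0n /H; last by move=> x /= hx; case: ifP => //; lia.
  by rewrite /= ltnSn subnn bin0 mulr1 addr0.
have {}jn : (j < n)%N by have := ltn_ord j; move: jn; rewrite -val_eqE /=; lia.
rewrite (@eq_fdiff _ _ (fun t => 'C((n - j.+1) + t, n)%:Z)); last first.
  move=> t _; rewrite /H; case: (ltnP j t) => jt; last by rewrite bin_small //; lia.
  by rewrite -bin_sub; [congr (Posz 'C(_, _))|]; lia.
by rewrite fdiff_bin ltnn mulr0.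
Qed.

End Differences.

Section HilbertFunction.
Variables (K : fieldType) (n : nat) (J : {mpoly K[n.+1]} -> Prop).
Variables (F : graded_free_resolution J) (e : nat).
Hypothesis linF : gfr_linear e F.

Lemma gfr_aug_homog_mx : homog_mx e (gfr_aug F).
Proof.
move=> i j; rewrite ord1; apply/dhomogP => m /gfr_aug_homog.
by rewrite linF addn0 => -[].
Qed.

Lemma gfr_diff_homog_mx i : homog_mx 1 (gfr_diff F i).
Proof.
move=> j k; apply/dhomogP => m /gfr_diff_homog.
rewrite !linF addnS => em; have h (a b : nat) : a%:Z = b.+1%:Z - b%:Z -> a = 1%N.
  by lia.
exact: h em.
Qed.

(* Dimensions of the homogeneous components: of J (shifted by one), of the
   kernel of the augmentation, and of the kernels of the differentials. *)
Definition gfr_dims i t : int :=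
  match i with
  | 0 => if t is k.+1 then (\dim (limg (lmap (gfr_aug F) k (k + e))))%:Z else 0
  | 1 => (\dim (lker (lmap (gfr_aug F) t (t + e))))%:Z
  | i'.+2 => (\dim (lker (lmap (gfr_diff F i') t t.+1)))%:Z
  end.

Lemma gfr_dims0 i : gfr_dims i 0 = 0.
Proof.
case: i => [|[|i]] //=.
  by rewrite (lmap_exact0 (@gfr_diff_homog_mx 0) gfr_aug_homog_mx (@gfr_exact0 _ _ _ F)) dimv0.
have := lmap_exact0 (@gfr_diff_homog_mx i.+1) (@gfr_diff_homog_mx i)
  (@gfr_exact _ _ _ F i).
by move=> ->; rewrite dimv0.
Qed.

Lemma gfr_dimsS i t : gfr_dims i t.+1 + gfr_dims i.+1 t =
  (gfr_rank F i)%:Z * 'C(t + n, t)%:Z.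
Proof.
rewrite -PoszM.
case: i => [|[|i]] /=; rewrite -PoszD.
- by rewrite -(lmap_rank (gfr_aug F) t (t + e)) addnC.
- rewrite (lmap_exact erefl (@gfr_diff_homog_mx 0) gfr_aug_homog_mx (@gfr_exact0 _ _ _ F)).
  by rewrite -(lmap_rank (gfr_diff F 0) t t.+1) addnC.
- rewrite (lmap_exact _ (@gfr_diff_homog_mx i.+1) (@gfr_diff_homog_mx i)
    (@gfr_exact _ _ _ F i)) ?addn1 //.
  by rewrite -(lmap_rank (gfr_diff F i.+1) t t.+1) addnC.
Qed.

Lemma linear_resolution_fdiff (Ms : nat -> seq 'X_{1..n.+1}) :
  (forall p, J p -> forall m, m \in msupp p -> J 'X_[m]) ->
  (forall k, uniq (Ms k)) ->
  (forall k m, m \in Ms k <-> mdeg m = (k + e)%N /\ J 'X_[m]) ->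
  iter n.+1 fdiff (fun t => if t is k.+1 then (size (Ms k))%:Z else 0) 0%N =
    (-1) ^+ n * (gfr_rank F n)%:Z.
Proof.
move=> monJ uM memM.
rewrite -(@fdiff_alternating n (fun i => (gfr_rank F i)%:Z) (gfr_dims 0)).
  apply: eq_fdiff => -[|k] _ //=.
  by rewrite (lmap_img_dim gfr_aug_homog_mx (gfr_aug_image F) monJ (uM k) (memM k)).
move=> t; rewrite (@alternating_recurrence gfr_dims (fun i => (gfr_rank F i)%:Z)
  (fun t => 'C(t + n, t)%:Z) gfr_dims0 gfr_dimsS).
by [].
Qed.

End HilbertFunction.

(** * Hilbert functions of completely lexsegment ideals *)

Lemma count_lt (T : eqType) (s : seq T) (p q : pred T) z : uniq s ->
  (forall x, x \in s -> p x -> q x) -> z \in s -> q z -> ~~ p z -> (count p s < count q s)%N.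
Proof.
move=> us pq zs qz pz; rewrite -!size_filter.
apply: (@uniq_leq_size _ (z :: filter p s) (filter q s)).
  by rewrite /= mem_filter (negPf pz) filter_uniq.
move=> x; rewrite inE !mem_filter => /orP [/eqP ->|/andP [px xs]]; first by rewrite qz.
by rewrite (pq _ xs px).
Qed.

Lemma count_map_bij (T : eqType) (s t : seq T) (p q : pred T) (f : T -> T) :
  uniq s -> uniq t -> injective f ->
  (forall x, (x \in t) && q x = (x \in map f (filter p s))) ->
  count q t = count p s.
Proof.
move=> us ut injf h; rewrite -!size_filter -(size_map f (filter p s)).
apply/perm_size/uniq_perm; rewrite ?filter_uniq //.
  by rewrite map_inj_uniq ?filter_uniq.
by move=> x; rewrite mem_filter andbC h.
Qed.

Lemma lem_lexle n (m1 m2 : 'X_{1..n}) : (m1 <= m2)%MM -> lexle m1 m2.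
Proof.
move=> /mnm_lepP le; rewrite lexleNgt; apply/negP => /lexltP [i _].
by rewrite ltnNge le.
Qed.

Lemma uniq_monos n d : uniq (monos n d).
Proof. exact: uniq_basis. Qed.

Lemma mdeg_lt n (m1 m2 : 'X_{1..n}) i : (forall j, m1 j <= m2 j)%N ->
  (m1 i < m2 i)%N -> (mdeg m1 < mdeg m2)%N.
Proof.
move=> le lt; rewrite !mdegE (bigD1 i) //= [X in (_ < X)%N](bigD1 i) //=.
by rewrite -addSn leq_add // leq_sum.
Qed.

Lemma lexle_pow0 n k (r : 'X_{1..n.+1}) : mdeg r = k ->
  lexle r (U_(ord0) *+ k)%MM.
Proof.
move=> dr; rewrite lexleNgt; apply/negP => /lexltP [i eqi].
rewrite mulmnE mnm1E; have [<-|i0] := eqVneq ord0 i.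
  by rewrite mul1n -dr mdegE (bigD1 ord0) //=; lia.
have := eqi ord0; rewrite mulmnE mnm1E eqxx; have := mdeg_ge2 r i0.
have ip : (0 < i)%N by rewrite lt0n eq_sym.
by rewrite dr => h1 /(_ ip) h2; lia.
Qed.

Lemma lexle_powmax n k (r : 'X_{1..n.+1}) : mdeg r = k ->
  lexle (U_(ord_max) *+ k)%MM r.
Proof.
move=> dr; rewrite lexleNgt; apply/negP => /lexltP [i eqi].
rewrite mulmnE mnm1E; have [ei|_] := eqVneq ord_max i; last by rewrite mul0n.
rewrite mul1n => lt.
have : (mdeg r < mdeg (U_(ord_max) *+ k : 'X_{1..n.+1}))%N.
  apply: (@mdeg_lt _ _ _ i); last by rewrite mulmnE mnm1E ei eqxx mul1n.
  move=> j; have [ji|ij] := ltnP j i; first by rewrite eqi.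
  suff -> : j = i by rewrite mulmnE mnm1E ei eqxx mul1n ltnW.
  by apply/val_inj/eqP; rewrite eqn_leq ij andbT -ei -ltnS ltn_ord.
by rewrite mdegMn mdeg1 mul1n dr ltnn.
Qed.

Section Counting.
Variables (n d : nat) (u v : 'X_{1..n.+1}).
Implicit Types (m z : 'X_{1..n.+1}).

(* the last exponent is determined by the others and the degree *)
Definition strip_last m : 'X_{1..n.+1} :=
  [multinom if i == ord_max then 0%N else m i | i < n.+1].

Lemma strip_lastE m (i : 'I_n.+1) : strip_last m i = if i == ord_max then 0%N else m i.
Proof. exact: mnmE. Qed.

Lemma lexlt_strip_last m1 m2 : mdeg m1 = mdeg m2 ->
  lexlt (strip_last m1) (strip_last m2) = lexlt m1 m2.
Proof.
move=> dm; apply/lexltP/lexltP => -[i eqi]; rewrite ?strip_lastE.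
  case: (i =P ord_max) => // /eqP i1 lt; exists i => // j ji.
  have := eqi _ ji; rewrite !strip_lastE; case: (j =P ord_max) => // ej.
  by move: ji; rewrite ej /= ltnNge -ltnS ltn_ord.
move=> lt; have [ei|ni] := eqVneq i ord_max.
  have : (mdeg m1 < mdeg m2)%N; last by rewrite dm ltnn.
  apply: (@mdeg_lt _ _ _ i) => // j; have [ji|] := ltnP j i; first by rewrite eqi.
  move=> ij; have -> : j = i; last exact: ltnW.
  by apply: val_inj; apply/eqP; rewrite eqn_leq ij andbT ei /= -ltnS ltn_ord.
exists i => [j ji|]; last by rewrite !strip_lastE (negPf ni).
by rewrite !strip_lastE; case: eqP => // _; apply: eqi.
Qed.

Lemma strip_last_max k m : strip_last (U_(ord_max) *+ k + m)%MM = strip_last m.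
Proof.
apply/mnmP => i; rewrite !strip_lastE mnmDE mulmnE mnm1E.
by rewrite [ord_max == i]eq_sym; case: eqP.
Qed.

(* m >= v, up to powers of the last variable *)
Definition above m := lexle (strip_last v) (strip_last m).

Definition first_vars k m := [forall i : 'I_n.+1, (n < i + k)%N ==> (m i == 0%N)].

Definition above_count j D :=
  count (fun m => above m && first_vars j m) (monos n.+1 D).

Hypotheses (dv : mdeg v = d) (d0 : (0 < d)%N).

Lemma above_mul (j : nat) m (k : 'I_n.+1) : (k + j = n)%N -> first_vars j m ->
  (d.-1 + j <= mdeg m)%N -> above (U_(k) + m)%MM = above m.
Proof.
move=> kj /forallP fv dm; apply/idP/idP; last first.
  move=> h; apply: lexle_trans h _; apply: lem_lexle; apply/mnm_lepP => i.
  by rewrite !strip_lastE mnmDE; case: ifP => // _; apply: leq_addl.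
case: (posnP j) => [j0|j0].
  have -> : k = ord_max by apply: val_inj => /=; lia.
  by rewrite /above -[U_(_)%MM]mulm1n strip_last_max.
apply: contraLR; rewrite /above -!lexltNge => /lexltP [i eqi].
rewrite !strip_lastE; case: (i =P ord_max) => // /eqP i1 lt.
have [ik|ki] := ltnP i k.
  apply/lexltP; exists i => [l li|]; rewrite !strip_lastE ?(negPf i1) mnmDE mnm1E.
    have -> : k == l = false by rewrite -val_eqE /=; lia.
    by have := eqi _ li; rewrite !strip_lastE.
  by have -> : k == i = false by rewrite -val_eqE /=; lia.
have : (mdeg m < mdeg v)%N; last by rewrite dv; lia.
apply: (@mdeg_lt _ _ _ i) => // l; case: (ltngtP l i) => [li|il|/val_inj -> //].
- have := eqi _ li; rewrite !strip_lastE; case: (l =P ord_max) => [el|_ -> //].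
  by have := ltn_ord i; move: li; rewrite el /=; lia.
- by have /implyP := fv l => /(_ _)/eqP -> //; lia.
- exact: ltnW.
Qed.

Lemma above_countS j D : (j <= n)%N -> (d.-1 + j <= D)%N ->
  above_count j D.+1 = (above_count j D + above_count j.+1 D.+1)%N.
Proof.
move=> jn dD; have kn : (n - j < n.+1)%N by lia.
pose k := Ordinal kn; have kj : (k + j = n)%N by rewrite /= subnK.
pose P m := above m && first_vars j m; pose s := filter P (monos n.+1 D.+1).
have -> : above_count j D.+1 = size s by rewrite size_filter.
rewrite -(count_predC (fun m => m k == 0%N)) addnC !count_filter.
congr (_ + _)%N; last first.
  apply: eq_count => m; rewrite /= /P andbCA; congr (_ && _).
  apply/andP/forallP => [[/eqP mk /forallP h] i|h].
    apply/implyP => hi; have := h i; case: (ltnP n (i + j)) => [_ //|ij _].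
    have -> // : i = k; last by rewrite mk.
    by apply: val_inj => /=; lia.
  split; first by have /implyP := h k; apply; lia.
  by apply/forallP => i; apply/implyP => hi; have /implyP := h i; apply; lia.
apply: (@count_map_bij _ _ _ _ _ (fun m => (U_(k) + m)%MM)); rewrite ?uniq_monos //.
  exact: addmI.
move=> m; rewrite mem_monos; apply/idP/mapP => [/= /and3P [/eqP dm mk /andP [Am Fm]]|].
  have em : (U_(k) + (m - U_(k)))%MM = m by rewrite addmC submK // lep1mP.
  have Fz : first_vars j (m - U_(k))%MM.
    apply/forallP => i; apply/implyP => hi; have /forallP/(_ i) := Fm.
    by rewrite hi mnmBE => /eqP ->.
  have dz : mdeg (m - U_(k))%MM = D.
    by have := congr1 (@mdeg _) em; rewrite mdegD mdeg1 dm => -[].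
  exists (m - U_(k))%MM => //; rewrite mem_filter mem_monos dz eqxx Fz !andbT.
  by rewrite -(@above_mul j _ k kj Fz) ?em ?dz.
move=> [z]; rewrite mem_filter mem_monos => /andP [/andP [Az Fz] /eqP dz] ->.
rewrite mdegD mdeg1 dz eqxx /= mnmDE mnm1E eqxx /= /P (@above_mul j _ k kj Fz) ?dz // Az /=.
apply/forallP => i; apply/implyP => hi; have /forallP/(_ i) := Fz.
rewrite hi mnmDE mnm1E => /eqP ->; have -> // : k == i = false.
by rewrite -val_eqE /=; lia.
Qed.

Lemma fdiff_above j t : (j <= n.+1)%N ->
  iter j fdiff (fun t => (above_count 0 (d.-1 + t))%:Z) t =
  (above_count j (d.-1 + t + j))%:Z.
Proof.
elim: j t => [|j IH] t jn /=; first by rewrite addn0.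
rewrite /fdiff !IH; try by lia.
rewrite addnS addSn (above_countS (j := j)); try by lia.
by rewrite addnS PoszD; lia.
Qed.

Lemma above_count_last D : (0 < D)%N -> above_count n.+1 D = 0%N.
Proof.
move=> D0; apply/eqP; rewrite -leqn0 leqNgt -has_count; apply/hasPn => m.
rewrite mem_monos => /eqP dm; apply/negP => /andP [_ /forallP h].
move: D0; rewrite -dm lt0n mdeg_eq0 => /eqP; apply.
apply/mnmP => i; rewrite mnm0E; have /implyP := h i => /(_ _)/eqP -> //.
by rewrite addnS ltnS leq_addl.
Qed.

Lemma fdiff_above0 :
  iter n.+1 fdiff (fun t => (above_count 0 (d.-1 + t))%:Z) 0%N = 0.
Proof. by rewrite fdiff_above // above_count_last //; lia. Qed.

Lemma above_count0 D : above_count 0 D = count above (monos n.+1 D).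
Proof.
apply: eq_count => m /=; rewrite (_ : first_vars 0 m) ?andbT //.
by apply/forallP => i; rewrite addn0; apply/implyP => h; have := ltn_ord i; lia.
Qed.

Hypotheses (du : mdeg u = d) (u0 : (0 < u ord0)%N) (le_vu : lexle v u).

Definition over_count t :=
  count (fun m => lexlt (U_(ord0) *+ t + u)%MM m) (monos n.+1 (d + t)).

Definition short_over_count :=
  count (fun z => lexlt u (U_(ord0) + z)%MM) (monos n.+1 d.-1).

Lemma over_countE t : over_count t = short_over_count.
Proof.
apply: (@count_map_bij _ _ _ _ _ (fun m => (U_(ord0) *+ t.+1 + m)%MM)); rewrite ?uniq_monos //.
  exact: addmI.
have eS z : (U_(ord0) *+ t.+1 + z)%MM = (U_(ord0) *+ t + (U_(ord0) + z))%MM.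
  by rewrite mulmSr addmA.
move=> m; rewrite mem_monos; apply/idP/mapP => [/andP [/eqP dm lt]|[z]].
  have m0 : (t < m ord0)%N.
    have := lexle_ord0 (lexltW lt); rewrite mnmDE mulmnE mnm1E eqxx; lia.
  have em : (U_(ord0) *+ t.+1 + (m - U_(ord0) *+ t.+1))%MM = m.
    rewrite addmC submK //; apply/mnm_lepP => i; rewrite mulmnE mnm1E.
    by case: eqP => [<-|_]; lia.
  exists (m - U_(ord0) *+ t.+1)%MM => //; rewrite mem_filter mem_monos.
  rewrite -(@lexltD2l _ (U_(ord0) *+ t)%MM) -eS em lt /=.
  have := congr1 (@mdeg _) em; rewrite mdegD mdegMn mdeg1 dm; lia.
rewrite mem_filter mem_monos => /andP [lt /eqP dz] ->.
by rewrite eS lexltD2l lt andbT !mdegD mdegMn !mdeg1 dz; apply/eqP; lia.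
Qed.

Definition seg_monos t := [seq m <- monos n.+1 (d + t) |
  lexle m (U_(ord0) *+ t + u)%MM && lexle (U_(ord_max) *+ t + v)%MM m].

Lemma size_seg_monos t :
  (size (seg_monos t))%:Z = (above_count 0 (d.-1 + t.+1))%:Z - short_over_count%:Z.
Proof.
rewrite -(over_countE t) above_count0 (_ : d.-1 + t.+1 = d + t)%N; last by lia.
suff -> : count above (monos n.+1 (d + t)) = (size (seg_monos t) + over_count t)%N.
  by lia.
rewrite -[LHS](size_filter above).
rewrite -(count_predC (fun m => lexle m (U_(ord0) *+ t + u)%MM)) !count_filter size_filter.
have aboveE m : m \in monos n.+1 (d + t) -> above m = lexle (U_(ord_max) *+ t + v)%MM m.
  rewrite mem_monos => /eqP dm; rewrite /above -(strip_last_max t) lexleNgt.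
  rewrite lexlt_strip_last -?lexleNgt //.
  by rewrite mdegD mdegMn mdeg1 dm dv; lia.
congr (_ + _)%N; apply: eq_in_count => m mD /=; rewrite aboveE //.
rewrite -lexltNge; case: (boolP (lexlt _ m)) => //= lt; rewrite (lexle_trans _ (lexltW lt)) //.
by apply: lexleD le_vu; apply: lexle_pow0; rewrite mdegMn mdeg1 mul1n.
Qed.

(* For a linear resolution this is (-1)^n times the last Betti number. *)
Lemma fdiff_seg_monos :
  iter n.+1 fdiff (fun t => if t is k.+1 then (size (seg_monos k))%:Z else 0) 0%N =
  (-1) ^+ n * ((count above (monos n.+1 d.-1))%:Z - short_over_count%:Z).
Proof.
set c := short_over_count; set a := count above _.
rewrite (@eq_fdiff _ _ (fun t => (above_count 0 (d.-1 + t))%:Z +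
   ((- c%:Z) * ('C(0 + t, 0))%:Z + (c%:Z - a%:Z) * (t == 0%N)%:Z))); last first.
  move=> [|t] _ /=; last by rewrite size_seg_monos bin0 -/c; lia.
  by rewrite addn0 above_count0 bin0 -/a; lia.
rewrite fdiffD fdiff_above0 add0r fdiffD.
have -> : iter n.+1 fdiff (fun t => - c%:Z * ('C(0 + t, 0))%:Z) 0%N =
    - c%:Z * iter n.+1 fdiff (fun t => ('C(0 + t, 0))%:Z) 0%N by exact: fdiffZ.
have -> : iter n.+1 fdiff (fun t => (c%:Z - a%:Z) * (t == 0%N)%:Z) 0%N =
    (c%:Z - a%:Z) * iter n.+1 fdiff (fun t => (t == 0%N)%:Z) 0%N by exact: fdiffZ.
rewrite fdiff_bin fdiff_first; last by case.
by rewrite mulr0 add0r mulr1 exprS mulN1r mulrN mulrC -mulrN opprB.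
Qed.

End Counting.

Lemma iter_shadowP n (B : 'X_{1..n} -> Prop) k m : iter k (@shadow n) B m <->
  exists g r, [/\ B g, mdeg r = k & m = (r + g)%MM].
Proof.
elim: k m => [|k IH] m /=.
  split=> [Bm|[g [r [Bg /eqP]]]]; last by rewrite mdeg_eq0 => /eqP -> ->; rewrite add0m.
  by exists m, 0%MM; rewrite mdeg0 add0m.
split=> [[w [i [/IH [g [r [Bg dr ->]]] ->]]]|[g [r [Bg dr ->]]]].
  by exists g, (U_(i) + r)%MM; rewrite mdegD mdeg1 dr addmA.
have [i ri] : exists i, (0 < r i)%N.
  case: (boolP [exists i, (0 < r i)%N]) => [/existsP //|].
  rewrite negb_exists => /forallP h; suff r0 : r = 0%MM by rewrite r0 mdeg0 in dr.
  by apply/mnmP => i; rewrite mnm0E; apply/eqP; rewrite -leqn0 leqNgt h.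
have er : (U_(i) + (r - U_(i)))%MM = r by rewrite addmC submK // lep1mP -lt0n.
exists (r - U_(i) + g)%MM, i; rewrite addmA er; split => //; apply/IH.
exists g, (r - U_(i))%MM; split => //.
by have := congr1 (@mdeg _) er; rewrite mdegD mdeg1 dr => -[].
Qed.

Section Complete.
Variables (n d : nat) (u v : 'X_{1..n.+1}).
Hypotheses (d2 : (2 <= d)%N) (du : mdeg u = d) (dv : mdeg v = d)
  (u0 : (0 < u ord0)%N) (le_vu : lexle v u) (compl : completely_lexsegment u v).
Implicit Types (m g : 'X_{1..n.+1}).

Lemma complete_mem k m : mdeg m = (d + k)%N ->
  (lexle m (U_(ord0) *+ k + u)%MM && lexle (U_(ord_max) *+ k + v)%MM m) <->
  exists2 g, lexseg u v g & (g <= m)%MM.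
Proof.
move=> dm; have [u' [v' [duv' le' Luv']]] := compl k.
have Lu : lexseg u v u by split => //; apply: lexle_refl.
have Lv : lexseg u v v by split; rewrite ?dv //; apply: lexle_refl.
have degS (i : 'I_n.+1) : mdeg (U_(i) *+ k : 'X_{1..n.+1}) = k.
  by rewrite mdegMn mdeg1 mul1n.
split=> [/andP [mu vm]|[g [dg gu vg] gm]].
  have /Luv' [du' uu' _] : iter k (@shadow _) (lexseg u v) (U_(ord0) *+ k + u)%MM.
    by apply/iter_shadowP; exists u, (U_(ord0) *+ k)%MM.
  have /Luv' [_ _ vv'] : iter k (@shadow _) (lexseg u v) (U_(ord_max) *+ k + v)%MM.
    by apply/iter_shadowP; exists v, (U_(ord_max) *+ k)%MM.
  have : lexseg u' v' m.
    split; [|exact: lexle_trans uu'|exact: lexle_trans vm].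
    by rewrite dm -du' mdegD degS du addnC.
  move=> /Luv'/iter_shadowP [g [r [Lg _ ->]]]; exists g => //; exact: lem_addl.
have dr : mdeg (m - g)%MM = k.
  by have := congr1 (@mdeg _) (submK gm); rewrite mdegD dm dg du; lia.
by rewrite -(submK gm) !lexleD ?lexle_pow0 ?lexle_powmax.
Qed.

Lemma pow_first_eq g : mdeg g = d -> g ord0 = d -> g = (U_(ord0) *+ d)%MM.
Proof.
move=> dg g0; apply/esym/lem_mdeg_eq; last by rewrite mdegMn mdeg1 mul1n dg.
by apply/mnm_lepP => i; rewrite mulmnE mnm1E; case: eqP => [<-|_]; lia.
Qed.

(* x_1^a x_2^(d-a+1) and x_1^(a+1) x_n^(d-a) have to be in the first shadow. *)
Lemma complete_equal : v ord0 = u ord0 ->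
  exists a : nat,
    [/\ (0 < a <= d)%N,
        u = (U_(ord0) *+ a + U_(inord 1) *+ (d - a))%MM
      & v = (U_(ord0) *+ a + U_(ord_max) *+ (d - a))%MM].
Proof.
move=> e0; exists (u ord0); move: (erefl (u ord0)); move: {1 3 4 5 6 7}(u ord0) => a ea.
have ad : (a <= d)%N by rewrite -du mdegE (bigD1 ord0) //= -ea leq_addr.
rewrite ea u0 -ea ad /=.
have [da|nd] := eqVneq d a.
  by rewrite da subnn !mulm0n !addm0 -da; split=> //; apply: pow_first_eq; rewrite ?e0 -?ea.
have n0 : (0 < n)%N.
  rewrite lt0n; apply: contra nd => /eqP n0; rewrite -du mdegE (bigD1 ord0) //=.
  rewrite big1 ?addn0 ?ea // => i /negP[]; apply/eqP/val_inj; have := ltn_ord i.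
  by rewrite {2}n0 ltnS leqn0 => /eqP.
have max0 : ord_max == ord0 :> 'I_n.+1 = false by rewrite -val_eqE /=; lia.
have v1 : (inord 1 : 'I_n.+1) = 1%N :> nat by rewrite inordK.
have i10 : inord 1 == ord0 :> 'I_n.+1 = false by rewrite -val_eqE /= v1.
have seg0 g : lexseg u v g -> g ord0 = a.
  by move=> [_ /lexle_ord0 h1 /lexle_ord0 h2]; move: h1 h2; rewrite e0 -ea; lia.
split => //.
  set y := (_ + _)%MM; have dy : mdeg y = d.
    by rewrite mdegD !mdegMn !mdeg1 !mul1n subnKC.
  have y0 : y ord0 = a by rewrite mnmDE !mulmnE !mnm1E eqxx i10; lia.
  pose m := (U_(inord 1) + y)%MM.
  have m0 : m ord0 = a by rewrite mnmDE mnm1E i10 y0.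
  have dm : mdeg m = (d + 1)%N by rewrite mdegD mdeg1 dy addnC.
  have em : m = (U_(ord0) *+ a + U_(inord 1) *+ (d.+1 - a))%MM.
    by rewrite /m /y addmA [(U_(inord 1) + _)%MM]addmC -addmA -mulmS subSn.
  have [|g Lg gm] := proj1 (complete_mem dm).
    apply/andP; split; first by apply/lexltW/lexlt_ord0; rewrite m0 mulm1n mnmDE mnm1E eqxx ea.
    rewrite mulm1n em; apply: lexle_first_two => //.
      by rewrite mdegD mdeg1 dv.
    by rewrite mnmDE mnm1E max0 e0 -ea.
  have g0 := seg0 _ Lg; have [dg gu _] := Lg; rewrite du in dg.
  suff gy : g = y.
    by apply: lexle_anti; rewrite lexle_first_two //= -gy.
  apply: lem_mdeg_eq; last by rewrite dg dy.
  apply/mnm_lepP => i; have := mnm_lepP gm i; rewrite /m /y !mnmDE !mulmnE !mnm1E.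
  have [<-|i0] := eqVneq ord0 i; first by rewrite i10 g0; lia.
  have [<-|_] := eqVneq (inord 1) i; last by lia.
  have : (g ord0 + g (inord 1) <= mdeg g)%N by apply: mdeg_ge2; rewrite eq_sym i10.
  by rewrite dg g0; lia.
set y := (_ + _)%MM; have dy : mdeg y = d.
  by rewrite mdegD !mdegMn !mdeg1 !mul1n subnKC.
have y0 : y ord0 = a by rewrite mnmDE !mulmnE !mnm1E eqxx max0; lia.
have ylast g : mdeg g = d -> g ord0 = a -> lexle y g.
  move=> dg g0; rewrite -(strip0K g) g0 lexleD2l lexle_powmax //.
  by have := mdeg_strip0 g; rewrite dg g0; lia.
pose m := (U_(ord0) + y)%MM.
have dm : mdeg m = (d + 1)%N by rewrite mdegD mdeg1 dy addnC.
have [|g Lg gm] := proj1 (complete_mem dm).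
  rewrite !mulm1n lexleD2l ylast //=; apply/lexltW/lexlt_ord0.
  by rewrite (mnmDE _ U_(ord_max)%MM) (mnmDE _ U_(ord0)%MM) !mnm1E max0 eqxx y0 e0 -ea.
have g0 := seg0 _ Lg; have [dg _ vg] := Lg; rewrite du in dg.
suff gy : g = y by apply: lexle_anti; rewrite {1}gy in vg; rewrite vg ylast // e0 -ea.
apply: lem_mdeg_eq; last by rewrite dg dy.
apply/mnm_lepP => i; have := mnm_lepP gm i; rewrite (mnmDE i U_(ord0)%MM y) mnm1E.
have [<-|_] := eqVneq ord0 i; first by rewrite g0 y0.
by [].
Qed.

Lemma linear_resolution_shape (K : fieldType) (J : {mpoly K[n.+1]} -> Prop) :
  eqideal J (mon_ideal (lexseg u v)) -> has_linear_resolution J ->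
  linear_shape d u v.
Proof.
move=> eJ [e [_ [F [_ linF]]]].
have vu0 := lexle_ord0 le_vu.
have [/complete_equal|nv] := eqVneq (v ord0) (u ord0); first by constructor 1.
case: (ltnP (v ord0) (u ord0 - 1)) => [|le]; first by constructor 2.
constructor 3; split; first by lia.
move=> w wp; have [dw wv _] := wp.
have w0 : w != 0%MM by rewrite -mdeg_eq0 dw dv; lia.
have [wm _] := max_index_spec w0; move: (max_index w) wm => l wl.
rewrite -addmBA ?lep1mP -?lt0n //; set z := (w - _)%MM.
have ez : (U_(l) + z)%MM = w by rewrite addmC submK // lep1mP -lt0n.
have dz : mdeg z = d.-1 by have := congr1 (@mdeg _) ez; rewrite mdegD mdeg1 dw dv; lia.
rewrite lexleNgt; apply/negP => uz.
have monJ p : J p -> forall m, m \in msupp p -> J 'X_[m].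
  move=> /eJ/mon_idealP h m /h [g Lg gm]; apply/eJ/mon_idealX; by exists g.
have JX m : J 'X_[m] <-> exists2 g, lexseg u v g & (g <= m)%MM.
  by rewrite eJ mon_idealX.
have Ju : J 'X_[u].
  by apply/JX; exists u; rewrite ?lepm_refl //; split => //; apply: lexle_refl.
have Jdeg m : J 'X_[m] -> (d <= mdeg m)%N.
  by move=> /JX [g [dg _ _] /lem_mdeg]; rewrite dg du.
have hA := gfr_aug_homog_mx linF.
have ed : e = d.
  apply/eqP; rewrite eqn_leq; apply/andP; split.
    have /(gfr_aug_image F) [x ex] := Ju.
    have : u \in msupp ('X_[u] : {mpoly K[n.+1]}) by rewrite msuppX mem_head.
    rewrite {1}ex mxE => /msupp_sum_le/flattenP [t /mapP [i _ ->]].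
    move=> /msuppM_le/allpairsP [[m1 m2] /= [_ h eu]].
    by rewrite -du eu mdegD (dhomogP _ _ _ (hA i 0) _ h) leq_addl.
  rewrite leqNgt; apply/negP => ed.
  have A0 : gfr_aug F = 0.
    apply/matrixP => i j; rewrite ord1 mxE; apply/eqP; rewrite -msupp_eq0.
    case em: (msupp _) => [//|m s].
    have ms : m \in msupp (gfr_aug F i 0) by rewrite em mem_head.
    have /monJ/(_ _ ms)/Jdeg : J (gfr_aug F i 0).
      by apply/(gfr_aug_image F); exists (delta_mx 0 i); rewrite -rowE mxE.
    by rewrite (dhomogP _ _ _ (hA i 0) _ ms) leqNgt ed.
  have /(gfr_aug_image F) [x] := Ju; rewrite A0 mulmx0 mxE => /eqP.
  by rewrite -msupp_eq0 msuppX.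
rewrite {e}ed in linF hA.
have memM k m : m \in seg_monos d u v k <-> mdeg m = (k + d)%N /\ J 'X_[m].
  rewrite mem_filter mem_monos JX [(k + d)%N]addnC; split.
    by move=> /andP [h /eqP dm]; split=> //; apply/(complete_mem dm).
  by move=> [dm /(complete_mem dm) ->]; rewrite dm eqxx.
have := linear_resolution_fdiff linF monJ (fun k => filter_uniq _ (uniq_monos _ _)) memM.
have d0 : (0 < d)%N by lia.
rewrite (fdiff_seg_monos dv d0 du u0 le_vu).
have lt : (count (above v) (monos n.+1 d.-1) < short_over_count d u)%N.
  have wz : ~~ above v z.
    rewrite /above -lexltNge -(strip_last_max 1) lexlt_strip_last; last first.
      by rewrite mdegD mulm1n mdeg1 dz dv; lia.
    apply: lexle_lt_trans wv; rewrite -ez !(addmC _ z) lexleD2l.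
    exact: (@lexle_powmax _ 1%N _ (mdeg1 l)).
  apply: (@count_lt _ _ _ _ z) => //; rewrite ?uniq_monos ?mem_monos ?dz //.
  move=> x; rewrite mem_monos => /eqP dx vx; apply: lexlt_le_trans uz _.
  rewrite lexleD2l lexleNgt; apply: contra wz => xz; apply: lexle_trans vx _.
  by apply: lexltW; rewrite lexlt_strip_last // dx dz.
move/(congr1 (fun x => (-1) ^+ n * x)); rewrite !mulrA -exprMn mulrNN mulr1 expr1n !mul1r.
lia.
Qed.

End Complete.

Lemma has_linear_quotients_ext (K : fieldType) n (J J' : {mpoly K[n]} -> Prop) :
  eqideal J J' -> has_linear_quotients J -> has_linear_quotients J'.
Proof.
by move=> eJ [s [[us es ms] hq]]; exists s; split => //; split=> // p; rewrite -eJ.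
Qed.

Lemma ideal_pow1 (K : fieldType) n (L : 'X_{1..n} -> Prop) (I : {mpoly K[n]} -> Prop) :
  eqideal I (mon_ideal L) -> eqideal (ideal_pow I 1) (mon_ideal L).
Proof.
move=> eI p; rewrite (ideal_pow_mon 1 eI); apply: eqideal_mon => m.
split=> [[[|g [|? ?]] [// _ hL ->]]|Lm].
  by rewrite /msum big_seq1; apply: hL; rewrite mem_head.
exists [:: m]; split; rewrite // /msum ?big_seq1 // => g.
by rewrite inE => /eqP ->.
Qed.

Theorem theorem2p11 (K : fieldType) (n d : nat) (u v : 'X_{1..n.+1})
  (I : {mpoly K[n.+1]} -> Prop) :
  (2 <= d)%N -> mdeg u = d -> mdeg v = d ->
  (0 < u ord0)%N -> lexle v u ->
  I = mon_ideal (K := K) (lexseg u v) ->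
  completely_lexsegment u v ->
  [<-> [\/ exists a : nat,
             [/\ (0 < a <= d)%N,
                 u = (U_(ord0) *+ a + U_(inord 1) *+ (d - a))%MM
               & v = (U_(ord0) *+ a + U_(ord_max) *+ (d - a))%MM],
           (v ord0 < u ord0 - 1)%N
         | v ord0 = (u ord0 - 1)%N /\
           forall w, is_lex_pred v w ->
             lexle (U_(ord0) + w - U_(max_index w))%MM u];
       has_linear_resolution I;
       has_linear_quotients I;
       forall N : nat, (1 <= N)%N -> has_linear_quotients (ideal_pow I N);
       forall N : nat, (1 <= N)%N -> has_linear_resolution (ideal_pow I N)].
Proof.
move=> d2 du dv u0 le_vu eI compl; set shape := or3 _ _ _.
have eI' : eqideal I (mon_ideal (lexseg u v)) by rewrite eI.
have eI1 := ideal_pow1 eI'.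
have degL g : lexseg u v g -> mdeg g = d by case=> ->.
have shape_quot N : shape -> has_linear_quotients (ideal_pow I N).
  by rewrite eI; apply: shape_linear_quotients.
have quot_res N : has_linear_quotients (ideal_pow I N) ->
    has_linear_resolution (ideal_pow I N).
  apply: (@linear_quotients_resolution K n.+1 (N * d) (prodset (lexseg u v) N)).
    by move=> m; apply: prodset_deg.
  exact: ideal_pow_mon.
have quot1 : has_linear_quotients (ideal_pow I 1) -> has_linear_quotients I.
  by apply: has_linear_quotients_ext => p; rewrite eI1 eI'.
have quot_res1 : has_linear_quotients I -> has_linear_resolution I.
  exact: (linear_quotients_resolution degL eI').
have res_shape : has_linear_resolution I -> shape.
  exact: (linear_resolution_shape d2 du dv u0 le_vu compl eI').
have res1_shape : has_linear_resolution (ideal_pow I 1) -> shape.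
  exact: (linear_resolution_shape d2 du dv u0 le_vu compl eI1).
tfae.
- by move=> /(shape_quot 1%N)/quot1/quot_res1.
- by move=> /res_shape/(shape_quot 1%N)/quot1.
- by move=> /quot_res1/res_shape h N _; apply: shape_quot.
- by move=> h N /h/quot_res.
- by move=> /(_ 1%N isT)/res1_shape.
Qed.
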